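(* Let $n\ge 2$. Suppose $\mathcal{P}\subseteq\mathcal{A}(n,n-1)$ has packing dimension $t>0$. For each $P\in\mathcal{P}$ let $P'\subseteq P$ be a subset of Hausdorff dimension $n-1$, and let $F=\bigcup_{P\in\mathcal{P}}P'$. Then $$\dim_P(F)\ \ge\ n-1+\frac{nt}{(n-1)t+n}.$$
   Context: $\mathcal{A}(n,n-1)$ denotes the set of all affine hyperplanes in $\mathbb{R}^n$. Each $P\in\mathcal{A}(n,n-1)$ is uniquely written $P=V+t$ with $V$ an $(n-1)$-dimensional linear subspace of $\mathbb{R}^n$ and $t\in V^\perp$. The metric on $\mathcal{A}(n,n-1)$ (with respect to which packing dimension of sets of planes is taken) is $\rho(V_1+t_1,V_2+t_2)=\sup_{|x|=1}|\pi_{V_1}x-\pi_{V_2}x|+|t_1-t_2|$, where $\pi_V$ is the orthogonal projection onto $V$. $\dim_P$ denotes packing dimension. *)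

(* Defs.v *)
From mathcomp Require Import all_boot all_order all_algebra.
From mathcomp Require Import all_classical all_reals all_analysis.
Set Implicit Arguments.
Unset Strict Implicit.
Unset Printing Implicit Defensive.
Import Order.TTheory GRing.Theory Num.Theory.
Import numFieldNormedType.Exports.
Local Open Scope classical_set_scope.
Local Open Scope ring_scope.

(* Dimensions are taken with respect to an explicit distance function [d], not
   the canonical metric of the carrier: on ['rV[R]_n] the latter comes from the
   sup norm. *)
Section Dimensions.
Context {R : realType} {T : Type} (d : T -> T -> R).
Implicit Types (A U : set T) (s delta : R).
Local Open Scope ereal_scope.

(* [diam set0 = -oo]. *)
Definition diam U : \bar R := ereal_sup [set (d x y)%:E | x in U & y in U].

(* Empty pieces contribute nothing to the sum, also when [s = 0]; thus finite
   covers are allowed. *)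
Definition hausdorff_content s delta A : \bar R :=
  ereal_inf [set \sum_(0 <= i <oo | U i != set0) diam (U i) `^ s
            | U in [set U : nat -> set T |
                A `<=` \bigcup_i U i /\ forall i, diam (U i) <= delta%:E]].

Definition hausdorff_measure s A : \bar R :=
  ereal_sup [set hausdorff_content s delta A | delta in [set r | (0 < r)%R]].

Definition hausdorff_dim A : \bar R :=
  ereal_inf [set s%:E | s in [set s | (0 <= s)%R /\ hausdorff_measure s A = 0]].

(* [+oo] when [A] has no finite cover by sets of diameter at most [delta]. *)
Definition covering_number delta A : \bar R :=
  ereal_inf [set k%:R%:E | k in [set k : nat | exists U : 'I_k -> set T,
    A `<=` \bigcup_i U i /\ forall i, diam (U i) <= delta%:E]].

Definition upper_box_dim A : \bar R :=
  limf_esup (fun delta => lne (covering_number delta A) / (- ln delta)%:E)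
            (0%R : R)^'+.

(* Packing dimension as the modified upper box dimension.  A piece that is not
   totally bounded has upper box dimension [+oo], so the pieces need not be
   required to be bounded. *)
Definition packing_dim A : \bar R :=
  ereal_inf [set ereal_sup (range (fun i => upper_box_dim (U i)))
            | U in [set U : nat -> set T | A `<=` \bigcup_i U i]].

End Dimensions.

Section AffinePlanes.
Context {R : realType}.

Definition dotv n (u v : 'rV[R]_n) : R := \sum_i u 0 i * v 0 i.

Definition eucl_norm n (u : 'rV[R]_n) : R := Num.sqrt (dotv u u).

Definition eucl_dist n (u v : 'rV[R]_n) : R := eucl_norm (u - v).

Definition is_orthoproj n (V : {vspace 'rV[R]_n}) (x v : 'rV[R]_n) : Prop :=
  v \in V /\ forall w, w \in V -> dotv (x - v) w = 0.

Definition orthoproj n (V : {vspace 'rV[R]_n}) (x : 'rV[R]_n) : 'rV[R]_n :=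
  xget 0 [set v | is_orthoproj V x v].

(* An [m]-dimensional affine plane [V + t] of R^n, given by its unique
   representation with [t] orthogonal to [V]. *)
Record aplane (n m : nat) := APlane {
  direction : {vspace 'rV[R]_n};
  translation : 'rV[R]_n;
  dim_direction : \dim direction = m;
  translation_ortho : forall v, v \in direction -> dotv translation v = 0 }.

Definition aplane_points (n m : nat) (P : aplane n m) : set 'rV[R]_n :=
  [set v + translation P | v in [set v | v \in direction P]].

Definition aplane_dist (n m : nat) (P Q : aplane n m) : R :=
  sup [set eucl_norm (orthoproj (direction P) x - orthoproj (direction Q) x)
      | x in [set x : 'rV[R]_n | eucl_norm x = 1]]
  + eucl_norm (translation P - translation Q).

Lemma dotvE n (u v : 'rV[R]_n) : dotv u v = (u *m v^T) 0 0.
Proof. by rewrite mxE; apply: eq_bigr => i _; rewrite mxE. Qed.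

Lemma dotvv_eq0 n (u : 'rV[R]_n) : dotv u u = 0 -> u = 0.
Proof.
move=> /eqP; rewrite psumr_eq0 => [/allP u0|i _]; last first.
  by rewrite -expr2 sqr_ge0.
apply/rowP => i; rewrite mxE; apply/eqP.
by have := u0 i; rewrite mem_index_enum mulf_eq0 orbb; apply.
Qed.

Lemma orthoprojP n (V : {vspace 'rV[R]_n}) (x : 'rV[R]_n) :
  is_orthoproj V x (orthoproj V x).
Proof.
pose A : 'M[R]_(\dim V, n) := \matrix_i (vbasis V)`_i.
have mulAE (c : 'rV[R]_(\dim V)) : c *m A = \sum_i c 0 i *: (vbasis V)`_i.
  by rewrite mulmx_sum_row; apply: eq_bigr => i _; rewrite rowK.
have AV (c : 'rV[R]_(\dim V)) : c *m A \in V.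
  rewrite mulAE; apply: rpred_sum => i _; apply: rpredZ.
  by apply/vbasis_mem/mem_nth; rewrite size_tuple.
have VA w : w \in V -> exists c : 'rV[R]_(\dim V), w = c *m A.
  move=> wV; exists (\row_i coord (vbasis V) i w).
  rewrite mulAE {1}(coord_vbasis wV).
  by apply: eq_bigr => i _; rewrite mxE.
have Afree (c : 'rV[R]_(\dim V)) : c *m A = 0 -> c = 0.
  rewrite mulAE => cA0; apply/rowP => i; rewrite mxE.
  by move/freeP: (basis_free (vbasisP V)) => /(_ (c 0) cA0).
have AAu : A *m A^T \in unitmx.
  rewrite -row_free_unit -kermx_eq0; apply/rowV0P => c /sub_kermxP cAA.
  apply: Afree; apply: dotvv_eq0.
  by rewrite dotvE trmx_mul !mulmxA -(mulmxA c) cAA mul0mx mxE.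
apply: xgetPex; exists (x *m A^T *m invmx (A *m A^T) *m A).
split=> // w /VA[c ->].
rewrite dotvE trmx_mul mulmxA mulmxBl -(mulmxA _ A) mulmxKV // subrr mul0mx.
by rewrite mxE.
Qed.

Lemma orthoproj_uniq n (V : {vspace 'rV[R]_n}) (x v v' : 'rV[R]_n) :
  is_orthoproj V x v -> is_orthoproj V x v' -> v = v'.
Proof.
move=> [vV ov] [v'V ov']; apply/eqP; rewrite -subr_eq0; apply/eqP/dotvv_eq0.
have wV : v - v' \in V by rewrite rpredB.
have := ov' _ wV; rewrite -{1}(subrK v x) -addrA.
rewrite dotvE mulmxDl mxE -!dotvE ov //.
by rewrite add0r.
Qed.

End AffinePlanes.

(* Main.v *)
(* An L2 counting argument on grids.  Fix a countable cover of F and a small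
   eps.  Countable stability of both dimensions gives a cover element U, a box
   and a subfamily of upper box dimension > t - eps such that every P' of the
   subfamily meets at least c d^-(n-1-eps) grid cells of side d in U and the
   box, for all d <= 1, and such that its hyperplanes are graphs over the same
   coordinate hyperplane.  Choose one hyperplane in each occupied cell of side
   th of the parameter space, M in total, with M > th^-(t-eps) up to a constant.
   Two hyperplanes at parameter distance r share at most C d^-(n-2) / r cells of
   side d, and the sum of 1/r over the chosen hyperplanes is largest when their
   parameters fill a cube of th-cells, hence is O(M^(1-1/n) / th).  For
   d = th M^-(1-1/n) the overlaps thus sum up to O(M d^-(n-1)), and the
   Cauchy-Schwarz inequality gives at least c M d^-(n-1-2 eps) cells of side d
   in U, where M is at least d^-s up to a constant, with 1/s = 1/(t-eps) + (n-1)/n. *)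
Require Import Defs.
From mathcomp Require Import all_boot all_order all_algebra.
From mathcomp Require Import all_classical all_reals all_analysis.
From mathcomp Require Import ring lra zify.
Set Implicit Arguments.
Unset Strict Implicit.
Unset Printing Implicit Defensive.
Import Order.TTheory GRing.Theory Num.Theory.
Import numFieldNormedType.Exports.

(** * Counting index functions whose coordinates have bounded spread *)

Lemma card_ord_diam K D (A : {set 'I_K}) :
  (forall a b, a \in A -> b \in A -> a <= b + D) -> #|A| <= D.+1.
Proof.
move=> AD; have [->|[a0 a0A]] := set_0Vmem A; first by rewrite cards0.
case: (arg_minnP (fun a : 'I_K => a : nat) a0A) => a aA amin.
pose f (b : 'I_K) : 'I_D.+1 := inord (b - a).
rewrite -(card_ord D.+1) -(card_in_imset (f := f)); first exact: max_card.
move=> b c bA cA /(congr1 val); rewrite /= !inordK ?ltnS ?leq_subLR ?AD //.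
by move=> /eqP; rewrite -(eqn_add2r a) !subnK ?amin // => /eqP/val_inj.
Qed.

(** The set lies in the product of its coordinate projections, and each projection has at most
    [D.+1] elements. *)
Lemma card_ffun_diam n K D (S : {set {ffun 'I_n -> 'I_K}}) :
  (forall k k', k \in S -> k' \in S -> forall a, k a <= k' a + D) ->
  #|S| <= D.+1 ^ n.
Proof.
move=> SD; pose F a := [set k a | k : {ffun 'I_n -> 'I_K} in S].
apply: (@leq_trans #|family F|).
  apply/subset_leq_card/fintype.subsetP => k kS.
  by apply/familyP => a; apply: imset_f.
rewrite card_family foldrE big_map big_enum /= -[X in _ ^ X](card_ord n).
rewrite -prod_nat_const.
apply: leq_prod => a _; apply: card_ord_diam => b c.
move=> /imsetP[k kS ->] /imsetP[k' k'S ->].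
exact: SD.
Qed.

(** Projection along coordinate [i], valued in the same type so that erasures can be iterated. *)
Definition erase n K (i : 'I_n) (k : {ffun 'I_n -> 'I_K.+1}) :=
  [ffun a => if a == i then ord0 else k a].

(** Within a fibre of [erase i] only the coordinate [i] varies, and the hypothesis bounds its
    spread. *)
Lemma card_erase n K D (i : 'I_n) (S : {set {ffun 'I_n -> 'I_K.+1}}) :
  (forall k k', k \in S -> k' \in S -> (forall a, a != i -> k a = k' a) ->
    k i <= k' i + D) ->
  #|S| <= D.+1 * #|[set erase i k | k in S]|.
Proof.
move=> SD; rewrite -sum1_card (partition_big_imset (erase i)) /= mulnC.
rewrite -sum_nat_const; apply: leq_sum => e eS; rewrite sum1_card.
pose T := [set k in S | erase i k == e].
have eqT a k k' : k \in T -> k' \in T -> a != i -> k a = k' a.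
  rewrite !inE => /andP[_ /eqP ke] /andP[_ /eqP k'e] ai.
  by move: ke; rewrite -k'e => /ffunP/(_ a); rewrite !ffunE (negPf ai).
apply: (@leq_trans #|[set k i | k : {ffun 'I_n -> 'I_K.+1} in T]|).
  rewrite card_in_imset; first by rewrite cardsE.
  move=> k k' kT k'T kk'i; apply/ffunP => a.
  by have [->//|ai] := eqVneq a i; exact: eqT.
apply: card_ord_diam => b c /imsetP[k kT ->] /imsetP[k' k'T ->].
apply: SD; last by move=> a ai; exact: eqT.
- by move: kT; rewrite inE => /andP[].
- by move: k'T; rewrite inE => /andP[].
Qed.

Lemma card_ffun_zero n K (I : {set 'I_n}) (S : {set {ffun 'I_n -> 'I_K.+1}}) :
  (forall k a, k \in S -> a \in I -> k a = ord0) -> #|S| <= K.+1 ^ (n - #|I|).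
Proof.
move=> SI.
have -> : n - #|I| = #|~: I| by rewrite [RHS]cardsCs finset.setCK card_ord.
rewrite -[X in X ^ _](card_ord K.+1) -(card_pffun_on (ord0 : 'I_K.+1)).
apply/subset_leq_card/fintype.subsetP => k kS; apply/pffun_onP; split=> //.
apply/fintype.subsetP => a; rewrite !inE; apply: contra => aI.
by rewrite (SI _ _ kS aI).
Qed.

Lemma card_erase1 n K D (j : 'I_n) (S : {set {ffun 'I_n -> 'I_K.+1}}) :
  (forall k k', k \in S -> k' \in S -> (forall a, a != j -> k a = k' a) ->
    k j <= k' j + D) ->
  #|S| <= D.+1 * K.+1 ^ n.-1.
Proof.
move=> SD; apply: leq_trans (card_erase SD) _; rewrite leq_mul2l /=.
rewrite -subn1 -(cards1 j); apply: card_ffun_zero => _ a /imsetP[k _ ->].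
by rewrite inE ffunE => ->.
Qed.

(** Erase [j], then [i]. Elements of the first image that agree off [i] come from elements of [S]
    that agree off [i] and [j]; hence the form of the second hypothesis. It serves to count the
    cells met by two hyperplanes at once. *)
Lemma card_erase2 n K D D' (i j : 'I_n) (S : {set {ffun 'I_n -> 'I_K.+1}}) :
  i != j ->
  (forall k k', k \in S -> k' \in S -> (forall a, a != j -> k a = k' a) ->
    k j <= k' j + D) ->
  (forall k k', k \in S -> k' \in S ->
    (forall a, a != i -> a != j -> k a = k' a) -> k i <= k' i + D') ->
  #|S| <= D.+1 * (D'.+1 * K.+1 ^ n.-2).
Proof.
move=> ij SD SD'; apply: leq_trans (card_erase SD) _; rewrite leq_mul2l /=.
set S1 := [set _ | _ in _].
have S1D k k' : k \in S1 -> k' \in S1 -> (forall a, a != i -> k a = k' a) ->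
    k i <= k' i + D'.
  move=> /imsetP[k0 k0S ->] /imsetP[k1 k1S ->] E.
  rewrite !ffunE (negPf ij); apply: SD' => // a ai aj.
  by have := E a ai; rewrite !ffunE (negPf aj).
apply: leq_trans (card_erase S1D) _; rewrite leq_mul2l /=.
have -> : n.-2 = n - #|[set i; j]| by rewrite cards2 ij subn2.
apply: card_ffun_zero => _ a /imsetP[_ /imsetP[k _ ->] ->].
by rewrite !inE !ffunE => /orP[->//|/eqP->]; rewrite eqxx; case: ifP.
Qed.

(** * Cauchy-Schwarz for overlapping finite sets *)

Lemma sum_nat_sqr (T : finType) (A : {set T}) (f : T -> nat) :
  (\sum_(x in A) f x) ^ 2 <= #|A| * \sum_(x in A) f x ^ 2.
Proof.
rewrite -(leq_pmul2l (isT : 0 < 2)).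
have -> : 2 * (\sum_(x in A) f x) ^ 2 =
    \sum_(x in A) \sum_(y in A) 2 * (f x * f y).
  rewrite -mulnn big_distrl big_distrr /=; apply: eq_bigr => x _.
  by rewrite big_distrr big_distrr.
apply: (@leq_trans (\sum_(x in A) \sum_(y in A) (f x ^ 2 + f y ^ 2))).
  by apply: leq_sum => x _; apply: leq_sum => y _; exact: nat_Cauchy.
under eq_bigr do rewrite big_split sum_nat_const.
by rewrite big_split sum_nat_const /= -big_distrr /= addnn -mul2n.
Qed.

(** Count each point of the union with its multiplicity: the multiplicities add up to the total size
    of the sets, their squares to the sizes of all pairwise intersections. *)
Lemma cauchy_schwarz_bigcup (I T : finType) (Q : {set I}) (A : I -> {set T}) :
  (\sum_(q in Q) #|A q|) ^ 2 <=
    #|\bigcup_(q in Q) A q| * \sum_(q in Q) \sum_(q' in Q) #|A q :&: A q'|.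
Proof.
set W := \bigcup_(q in Q) A q.
have AW q : q \in Q -> A q \subset W by move=> qQ; exact: finset.bigcup_sup.
have -> : \sum_(q in Q) #|A q| = \sum_(x in W) \sum_(q in Q) (x \in A q).
  rewrite exchange_big /=; apply: eq_bigr => q /AW qW.
  rewrite -sum1_card big_mkcond [RHS]big_mkcond; apply: eq_bigr => x _ /=.
  by case xA : (x \in A q); rewrite ?if_same // (fintype.subsetP qW).
apply: leq_trans (sum_nat_sqr _ _) _; rewrite leq_mul2l; apply/orP; right.
rewrite leq_eqVlt; apply/orP; left; apply/eqP.
under eq_bigr => x _.
  rewrite -mulnn big_distrl; under eq_bigr do rewrite big_distrr.
  over.
rewrite exchange_big /=; apply: eq_bigr => q /AW qW.
rewrite exchange_big /=; apply: eq_bigr => q' _.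
under eq_bigr do rewrite mulnb -finset.in_setI.
rewrite -sum1_card big_mkcond [RHS]big_mkcond; apply: eq_bigr => x _ /=.
by rewrite !inE; case xA : (x \in A q); rewrite ?if_same //= (fintype.subsetP qW).
Qed.

Local Open Scope classical_set_scope.
Local Open Scope ring_scope.

(** * Sums of inverse distances over a grid *)

Section Harmonic.
Context {R : realFieldType}.

(** For [l <= L] the two sides are equal, by telescoping 1/k - 1/(k+1). This is the summation by
    parts that reduces a sum of inverses to counts of the q with [l q <= k]. *)
Lemma inv_le_telescope (l L : nat) : (0 < l)%N -> (0 < L)%N ->
  (l%:R^-1 : R) <= L%:R^-1 +
    \sum_(1 <= k < L) (if (l <= k)%N then (k * k.+1)%:R^-1 else 0).
Proof.
move=> l0; elim: L => // -[_ _|L IH _].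
  by rewrite big_geq // addr0 invr1 invf_le1 ?ltr0n // ler1n.
rewrite big_nat_recr //=; have [lL|Ll] := leqP l L.+1.
  apply: le_trans (IH _) _ => //; rewrite addrCA addrC lerD2r natrM.
  have L0 : 0 < L.+1%:R :> R by rewrite ltr0n.
  rewrite -(natr1 L.+1); move: L.+1%:R L0 => z z0.
  by rewrite le_eqVlt; apply/orP; left; apply/eqP; field; lra.
rewrite addr0 -[leLHS]addr0 lerD //.
  by rewrite lef_pV2 ?posrE ?ltr0n // ler_nat.
by apply: sumr_ge0 => k _; case: ifP => // _; rewrite invr_ge0.
Qed.

(** After exchanging the sums, each k < L carries at most (2k+1)^n <= (3k)^n terms of weight
    1/(k(k+1)), hence at most 3^n L^(n-2). *)
Lemma sum_inv_le (T : finType) (Q : {set T}) (l : T -> nat) (n L : nat) :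
  (2 <= n)%N -> (0 < L)%N ->
  (forall k, (0 < k)%N -> #|[set q in Q | (l q <= k)%N]| <= (2 * k).+1 ^ n)%N ->
  \sum_(q in Q | (2 <= l q)%N) ((l q)%:R^-1 : R) <=
    #|Q|%:R / L%:R + 3 ^+ n * L%:R ^+ n.-1.
Proof.
move=> n2 L0 Ql.
have L0' : 0 < L%:R :> R by rewrite ltr0n.
apply: (@le_trans _ _ (\sum_(q in Q) (L%:R^-1 +
    \sum_(1 <= k < L) (if (l q <= k)%N then (k * k.+1)%:R^-1 else 0)) : R)).
  rewrite big_mkcondr; apply: ler_sum => q qQ; case: ifP => [lq|_].
    by apply: inv_le_telescope => //; exact: leq_trans lq.
  apply: addr_ge0; first by rewrite invr_ge0.
  by apply: sumr_ge0 => k _; case: ifP => // _; rewrite invr_ge0.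
rewrite big_split /= sumr_const -[_ *+ _]mulr_natl lerD2l exchange_big /=.
(* The bound is split into L equal terms, one for each k < L; the term k = 0 has no partner on the
   left and is dropped. *)
have -> : 3 ^+ n * L%:R ^+ n.-1 = \sum_(0 <= k < L) (3 ^+ n * L%:R ^+ n.-2 : R).
  rewrite sumr_const_nat subn0 -[RHS]mulr_natr -mulrA -exprSr prednK //.
  by case: n n2 {Ql} => // -[].
rewrite [leRHS]big_ltn // -[leLHS]add0r lerD //.
apply: ler_sum_nat => k /andP[k1 kL].
rewrite -big_mkcondr sumr_const -[leLHS]mulr_natl /=.
have -> : #|[pred q in Q | (l q <= k)%N]| = #|[set q in Q | (l q <= k)%N]|.
  by apply: eq_card => q; rewrite !inE.
have k0 : 0 < k%:R :> R by rewrite ltr0n.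
rewrite ler_pdivrMr ?ltr0n ?muln_gt0 ?k1 //.
apply: (@le_trans _ _ ((3 * k) ^ n)%:R).
  rewrite ler_nat; apply: leq_trans (Ql k k1) _; rewrite leq_exp2r; lia.
rewrite natrX natrM exprMn -mulrA ler_wpM2l ?exprn_ge0 //.
have -> : n = n.-2.+2 by case: n n2 {Ql} => // -[].
rewrite /= !exprSr -mulrA -natrM; apply: ler_pM => //.
- by rewrite lerXn2r ?nnegrE ?ler0n // ler_nat ltnW.
- by rewrite ler_nat leq_mul.
Qed.

End Harmonic.

(** * Grid cells met by one or two hyperplanes *)

Section Cells.
Context {R : realType} {n : nat}.
Implicit Types (x y u v : 'rV[R]_n) (m d b : R).

Definition box m : set 'rV[R]_n := [set x | forall a, `|x 0 a| <= m].

(** The largest cell index in one coordinate when [-m, m] is cut into pieces of side d from its left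
    end. *)
Definition mesh m d := Num.truncn (2 * m / d).

(** Meaningful for x in [box m] only; elsewhere the index is an artefact of truncation and of
    [inord]. *)
Definition cell m d x : {ffun 'I_n -> 'I_(mesh m d).+1} :=
  [ffun a => inord (Num.truncn ((x 0 a + m) / d))].

Lemma cell_itv m d x a : 0 < d -> box m x ->
  (cell m d x a)%:R <= (x 0 a + m) / d < (cell m d x a)%:R + 1.
Proof.
move=> d0 /(_ a); rewrite ler_norml => /andP[xm xm'].
have xm0 : 0 <= (x 0 a + m) / d by apply: divr_ge0; lra.
rewrite ffunE inordK; first by rewrite natr1 truncn_itv.
by rewrite ltnS /mesh le_truncn // ler_wpM2r ?invr_ge0 ?(ltW d0) //; lra.
Qed.

Lemma cell_eq_le m d x y a : 0 < d -> box m x -> box m y ->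
  cell m d x a = cell m d y a -> `|x 0 a - y 0 a| <= d.
Proof.
move=> d0 bx by_ E.
have /andP[x1 x2] := cell_itv a d0 bx; have /andP[y1 y2] := cell_itv a d0 by_.
move: x1 x2 y1 y2; rewrite E !ler_pdivlMr // !ltr_pdivrMr // => *.
by rewrite ler_norml; apply/andP; split; lra.
Qed.

Lemma leq_cell m d x y a (D : nat) : 0 < d -> box m x -> box m y ->
  x 0 a - y 0 a <= D%:R * d -> (cell m d x a <= cell m d y a + D)%N.
Proof.
move=> d0 bx by_ E.
have /andP[x1 x2] := cell_itv a d0 bx; have /andP[y1 y2] := cell_itv a d0 by_.
move: x1 x2 y1 y2; rewrite !ler_pdivlMr // !ltr_pdivrMr //.
move: (cell m d x a : nat) (cell m d y a : nat) => cx cy x1 x2 y1 y2.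
rewrite -ltnS -(ltr_nat R) -natr1 natrD -(ltr_pM2r d0); lra.
Qed.

Lemma card_cells_le m d : 1 <= m -> 0 < d <= 1 ->
  (mesh m d).+1%:R <= 3 * m / d.
Proof.
move=> m1 /andP[d0 d1]; rewrite -natr1 /mesh.
have : (Num.truncn (2 * m / d))%:R <= 2 * m / d.
  by rewrite truncn_le //; apply: divr_ge0; lra.
rewrite !ler_pdivlMr // => ?; nra.
Qed.

Lemma ler_sum_const (F : 'I_n -> R) c : (forall a, F a <= c) ->
  \sum_a F a <= n%:R * c.
Proof.
move=> Fc; rewrite -[n in leRHS]card_ord -sum1_card natr_sum mulr_suml.
by apply: ler_sum => a _; rewrite mul1r.
Qed.

Lemma norm_dotv_le x y c c' : 0 <= c -> 0 <= c' ->
  (forall a, `|x 0 a| <= c) -> (forall a, `|y 0 a| <= c') ->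
  `|dotv x y| <= n%:R * (c * c').
Proof.
move=> c0 c'0 xc yc; apply: le_trans (ler_norm_sum _ _ _) _.
by apply: ler_sum_const => a; rewrite normrM ler_pM.
Qed.

Lemma dotvBl x y u : dotv (x - y) u = dotv x u - dotv y u.
Proof. by rewrite -sumrB; apply: eq_bigr => a _; rewrite !mxE mulrBl. Qed.

Lemma dotvBr x y u : dotv u (x - y) = dotv u x - dotv u y.
Proof. by rewrite -sumrB; apply: eq_bigr => a _; rewrite !mxE mulrBr. Qed.

Definition hits m d (A : set 'rV[R]_n)
    (k : {ffun 'I_n -> 'I_(mesh m d).+1}) :=
  exists x, [/\ box m x, A x & cell m d x = k].

Definition hyper u b : set 'rV[R]_n := [set x | dotv x u = b].

(** Solving [dotv (x - x') u = 0] for the coordinate [j], whose coefficient is 1, shows that the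
    hyperplane is a graph with slopes at most 1 over the other coordinates. *)
Lemma normal_coord_le j u b d x x' : 0 <= d ->
  u 0 j = 1 -> (forall a, `|u 0 a| <= 1) -> hyper u b x -> hyper u b x' ->
  (forall a, a != j -> `|x 0 a - x' 0 a| <= d) ->
  x 0 j - x' 0 j <= n%:R * d.
Proof.
move=> d0 uj u1 xu x'u xx'.
have : dotv (x - x') u = 0 by rewrite dotvBl xu x'u subrr.
rewrite /dotv (bigD1 j) //= uj mulr1 !mxE.
move=> /eqP; rewrite addr_eq0 => /eqP ->.
apply: le_trans (ler_norm _) _; rewrite normrN.
apply: le_trans (ler_norm_sum _ _ _) _; rewrite big_mkcond.
apply: ler_sum_const => a; case: ifP => // aj; rewrite normrM -[leRHS]mulr1.
by rewrite ler_pM // !mxE xx'.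
Qed.

Lemma card_hits1 j m d u b
    (S : {set {ffun 'I_n -> 'I_(mesh m d).+1}}) :
  0 < d -> u 0 j = 1 -> (forall a, `|u 0 a| <= 1) ->
  (forall k, k \in S -> hits (hyper u b) k) ->
  (#|S| <= n.+1 * (mesh m d).+1 ^ n.-1)%N.
Proof.
move=> d0 uj u1 Su; apply: (@card_erase1 _ _ _ j) => k k'.
move=> /Su[x [xm xu <-]] /Su[y [ym yu <-]] E.
apply: leq_cell => //; apply: (@normal_coord_le j u b) => //; first exact: ltW.
by move=> a /E; exact: cell_eq_le.
Qed.

(** The difference of the two equations does not involve coordinate [j] and has its largest
    coefficient, of modulus h, at [i]. So the remaining coordinates fix the [i]-th one up to about
    4nd / h, and then one equation fixes the [j]-th up to nd. *)
Lemma card_hits2 i j m d u u' b b'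
    (S : {set {ffun 'I_n -> 'I_(mesh m d).+1}}) (D : nat) :
  0 < d -> i != j ->
  u 0 j = 1 -> (forall a, `|u 0 a| <= 1) ->
  u' 0 j = 1 -> (forall a, `|u' 0 a| <= 1) ->
  (forall a, `|u 0 a - u' 0 a| <= `|u 0 i - u' 0 i|) ->
  4 * n%:R <= D%:R * `|u 0 i - u' 0 i| ->
  (forall k, k \in S -> hits (hyper u b) k /\ hits (hyper u' b') k) ->
  (#|S| <= n.+1 * (D.+1 * (mesh m d).+1 ^ n.-2))%N.
Proof.
move=> d0 ij uj u1 u'j u'1; set h := `|_| => uh hD SP.
apply: (@card_erase2 _ _ _ _ i j) => // k k'.
  move=> /SP[[x [xm xu <-]] _] /SP[[y [ym yu <-]] _] E.
  apply: leq_cell => //; apply: (@normal_coord_le j u b) => //.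
    exact: ltW.
  by move=> a /E; exact: cell_eq_le.
move=> /SP[[x [xm xu xk]] [y [ym yu yk]]].
move=> /SP[[x' [x'm x'u x'k]] [y' [y'm y'u y'k]]] E.
rewrite -xk -x'k; apply: leq_cell => //.
have h0 : 0 <= h by exact: normr_ge0.
have h2 : h <= 2.
  by apply: le_trans (ler_normB _ _) _; rewrite (natrD _ 1 1) lerD.
have n0 : 0 < n%:R :> R by rewrite ltr0n (leq_ltn_trans _ (ltn_ord i)).
have hp : 0 < h.
  rewrite lt_def h0 andbT; apply/eqP => hE.
  by move: hD; rewrite hE mulr0; lra.
have xx' a : a != i -> a != j -> `|x 0 a - x' 0 a| <= d.
  by move=> ai aj; apply: (@cell_eq_le m) => //; rewrite xk x'k E.
have xy a : `|x 0 a - y 0 a| <= d by apply: (@cell_eq_le m) => //; rewrite xk yk.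
have xy' a : `|x' 0 a - y' 0 a| <= d.
  by apply: (@cell_eq_le m) => //; rewrite x'k y'k.
(* [x - x'] is orthogonal to [u], and nearly orthogonal to [u'] since [y - y']
   is orthogonal to [u']. *)
have : dotv (x - x') (u - u') = dotv ((y - x) - (y' - x')) u'.
  by rewrite !(dotvBl, dotvBr) xu x'u yu y'u; ring.
rewrite {1}/dotv (bigD1 i) //= !mxE => /eqP.
rewrite eq_sym -subr_eq eq_sym => /eqP P.
(* The first term pays for passing from x to y inside a cell, the second for the coordinates other
   than [i]. As h <= 2, together they are at most 4nd. *)
have {P} : `|(x 0 i - x' 0 i) * (u 0 i - u' 0 i)| <=
    n%:R * (2 * d) + n%:R * (d * h).
  rewrite P; apply: le_trans (ler_normB _ _) _; apply: lerD.
    rewrite -[2 * d]mulr1; apply: norm_dotv_le => //; first by lra.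
    move=> a; rewrite !mxE; apply: le_trans (ler_normB _ _) _.
    by rewrite mulrDl mul1r lerD // distrC.
  apply: le_trans (ler_norm_sum _ _ _) _; rewrite big_mkcond.
  apply: ler_sum_const => a; have dh0 : 0 <= d * h by rewrite mulr_ge0 // ltW.
  case: ifP => // ai; rewrite normrM !mxE.
  have [->|aj] := eqVneq a j; first by rewrite uj u'j subrr normr0 mulr0.
  by apply: ler_pM => //; exact: xx'.
rewrite normrM -/h => xh; apply: le_trans (ler_norm _) _.
rewrite -(ler_pM2r hp); apply: (le_trans xh).
apply: (@le_trans _ _ (4 * n%:R * d)).
  have : n%:R * d * h <= n%:R * d * 2 by rewrite ler_wpM2l // mulr_ge0 // ltW.
  lra.
by rewrite [leRHS]mulrAC ler_wpM2r // ltW.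
Qed.

End Cells.

(** One constant large enough for both cases of [card_overlap] and for the cells of a single
    hyperplane. *)
Definition overlap_const {R : realType} (n : nat) (m : R) : R :=
  8 * n%:R * n.+1%:R ^+ 2 * (3 * m) ^+ n.-1.

(** * Overlaps of the hyperplanes of one chart *)

Section Charts.
Context {R : realType} {n : nat}.
Implicit Types (w x y : 'rV[R]_n) (m d r : R) (j : 'I_n).

Definition normal j w : 'rV[R]_n := \row_a (if a == j then 1 else w 0 a).

(* The hyperplanes with a normal vector whose [j]-th coordinate is maximal are
   parametrized by the [w] with [slopes j w]: the coordinates [a != j] of [w]
   are the slopes, and the [j]-th one is the intercept. *)
Definition chart j w : set 'rV[R]_n := hyper (normal j w) (w 0 j).

Definition slopes j w := forall a, `|normal j w 0 a| <= 1.


Lemma normalj j w : normal j w 0 j = 1.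
Proof. by rewrite mxE eqxx. Qed.

(** With x, y in the common cell and normals u, u', the intercepts differ by x.(u - u') + (x -
    y).u'. So hyperplanes that share a cell and have close normals have close parameters. *)
Lemma param_diff_le j m d w w' (k : {ffun 'I_n -> 'I_(mesh m d).+1}) h :
  0 < d -> 1 <= m -> slopes j w' -> (0 < n)%N ->
  hits (chart j w) k -> hits (chart j w') k ->
  0 <= h -> (forall a, `|normal j w 0 a - normal j w' 0 a| <= h) ->
  forall a, `|w 0 a - w' 0 a| <= n%:R * (m * h) + n%:R * d.
Proof.
move=> d0 m1 sw' n0 [x [xm xw xk]] [y [ym yw' yk]] h0 wh a.
have n1 : 1 <= n%:R :> R by rewrite ler1n.
have [->|aj] := eqVneq a j.
  have -> : w 0 j - w' 0 j =
      dotv x (normal j w - normal j w') + dotv (x - y) (normal j w').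
    by rewrite dotvBr dotvBl xw yw'; ring.
  apply: le_trans (ler_normD _ _) _; apply: lerD.
    apply: norm_dotv_le => //; first by lra.
    by move=> a'; rewrite mxE [in X in _ + X]mxE; exact: wh.
  rewrite -[d in n%:R * d]mulr1; apply: norm_dotv_le => //; first exact: ltW.
  by move=> a'; rewrite !mxE; apply: (@cell_eq_le _ _ m) => //; rewrite xk yk.
have := wh a; rewrite !mxE (negPf aj) => /le_trans; apply.
have mh : h <= m * h by rewrite ler_peMl.
have : m * h <= n%:R * (m * h) by rewrite ler_peMl // (le_trans h0).
by have : 0 <= n%:R * d by [rewrite mulr_ge0 // ltW]; lra.
Qed.

(** If r <= 2nd, the count for a single hyperplane suffices, since then 1/d <= 2n/r. Otherwise a
    common cell forces the normals apart, and [card_hits2] applies. *)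
Lemma card_overlap j m d w w' r
    (S : {set {ffun 'I_n -> 'I_(mesh m d).+1}}) :
  (2 <= n)%N -> 1 <= m -> 0 < d <= 1 -> slopes j w -> slopes j w' -> 0 < r ->
  (exists a, r <= `|w 0 a - w' 0 a|) ->
  (forall k, k \in S -> hits (chart j w) k /\ hits (chart j w') k) ->
  #|S|%:R <= overlap_const n m * d^-1 ^+ n.-2 / r.
Proof.
move=> n2 m1 d01 sw sw' r0 [a0 ra0] SP.
have /andP[d0 d1] := d01.
have Kd := card_cells_le m1 d01; rewrite -/(mesh m d) in Kd.
have n1 : 1 <= n%:R :> R by rewrite ler1n ltnW.
have di0 : 0 < d^-1 by rewrite invr_gt0.
have [->|[k0 k0S]] := set_0Vmem S.
  by rewrite cards0 mulr_ge0 ?invr_ge0 ?(ltW r0) // !mulr_ge0 // exprn_ge0 //; lra.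
have XE (x : R) : x ^+ n.-1 = x * x ^+ n.-2.
  by rewrite -exprS prednK // -ltnS prednK // ltnW.
have KX : ((mesh m d).+1%:R : R) ^+ n.-2 <= (3 * m) ^+ n.-2 * d^-1 ^+ n.-2.
  by rewrite -exprMn lerXn2r ?nnegrE //; apply: mulr_ge0; lra.
have m3 : 0 <= (3 * m) ^+ n.-2 by rewrite exprn_ge0 //; lra.
have di2 : 0 <= d^-1 ^+ n.-2 by rewrite exprn_ge0 // ltW.
pose z : R := (3 * m) ^+ n.-2 * d^-1 ^+ n.-2.
have z0 : 0 <= z by exact: mulr_ge0.
have [rd|dr] := leP r (2 * n%:R * d).
  have SN : (#|S| <= n.+1 * (mesh m d).+1 ^ n.-1)%N.
    apply: (@card_hits1 _ _ j m d (normal j w) (w 0 j)) => //.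
      exact: normalj.
    by move=> k /SP[].
  rewrite -(ler_nat R) natrM natrX XE in SN; apply: le_trans SN _.
  apply: (@le_trans _ _ (n.+1%:R * ((3 * m / d) * z))).
    rewrite ler_wpM2l //; apply: ler_pM => //; exact: exprn_ge0.
  have dr' : d^-1 <= 2 * n%:R / r.
    by rewrite -[d^-1]mul1r ler_pdivrMr // mulrAC ler_pdivlMr // mul1r.
  apply: (@le_trans _ _ (n.+1%:R * ((3 * m * (2 * n%:R / r)) * z))).
    by rewrite ler_wpM2l // ler_wpM2r // ler_wpM2l //; lra.
  rewrite /overlap_const XE.
  have -> : 8 * n%:R * n.+1%:R ^+ 2 * (3 * m * (3 * m) ^+ n.-2) * d^-1 ^+ n.-2 / r
      = n.+1%:R * (3 * m * (2 * n%:R / r) * z) * (4 * n.+1%:R).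
    by rewrite /z; ring.
  rewrite ler_peMr //.
    by rewrite !mulr_ge0 ?invr_ge0 // ?(ltW r0) //; lra.
  by rewrite -natrM ler1n.
pose F a := `|normal j w 0 a - normal j w' 0 a|.
have [i _ iF] : exists2 i, true & forall a, F a <= F i.
  by case: (@arg_maxP _ _ _ j xpredT F) => // i _ iF; exists i => // a; exact: iF.
have := iF; set h := F i => hF.
have h0 : 0 <= h by exact: normr_ge0.
(* By [param_diff_le], r <= nmh + nd, and nd < r/2 in this case. *)
have rh : r <= 2 * n%:R * m * h.
  have [H1 H2] := SP _ k0S.
  have := param_diff_le d0 m1 sw' (ltnW n2) H1 H2 h0 hF a0; lra.
have hp : 0 < h.
  rewrite lt_def h0 andbT; apply/eqP => hE.
  by move: rh; rewrite hE mulr0; lra.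
have ij : i != j.
  by apply/eqP => ij; move: hp; rewrite /h /F ij !normalj subrr normr0 ltxx.
have h2 : h <= 2.
  by apply: le_trans (ler_normB _ _) _; rewrite (natrD _ 1 1) lerD.
pose D := (Num.truncn (4 * n%:R / h)).+1.
have Dh : 4 * n%:R <= D%:R * h.
  by rewrite -ler_pdivrMr // ltW // truncnS_gt.
have SN := card_hits2 d0 ij (normalj j w) sw (normalj j w') sw' hF Dh SP.
rewrite -(ler_nat R) !natrM natrX in SN; apply: le_trans SN _.
have DD : D.+1%:R <= (4 * n%:R + 4) * (2 * n%:R * m) / r.
  apply: (@le_trans _ _ ((4 * n%:R + 4) / h)).
    have : (Num.truncn (4 * n%:R / h))%:R <= 4 * n%:R / h.
      by rewrite truncn_le //; apply: divr_ge0 => //; lra.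
    rewrite /D -2!natr1 !ler_pdivlMr //; lra.
  rewrite ler_pdivlMr // [leLHS]mulrAC ler_pdivrMr // -[leRHS]mulrA.
  by apply: ler_wpM2l => //; lra.
apply: (@le_trans _ _ (n.+1%:R * ((4 * n%:R + 4) * (2 * n%:R * m) / r * z))).
  by rewrite ler_wpM2l // ler_pM // exprn_ge0.
rewrite /overlap_const XE /z -natr1.
have -> : 8 * n%:R * (n%:R + 1) ^+ 2 * (3 * m * (3 * m) ^+ n.-2) * d^-1 ^+ n.-2 / r =
  ((n%:R + 1) * ((4 * n%:R + 4) * (2 * n%:R * m) / r *
    ((3 * m) ^+ n.-2 * d^-1 ^+ n.-2))) * 3 by ring.
rewrite ler_peMr //; last by lra.
by rewrite !mulr_ge0 ?invr_ge0 // ?(ltW r0) //; lra.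
Qed.

(** The maximum of the two truncated differences is the distance of the indices, so this bounds a
    ball in the sup norm. *)
Lemma card_near_le K (Q : {set {ffun 'I_n -> 'I_K}}) (q : {ffun 'I_n -> 'I_K})
    (k : nat) :
  (#|[set q' in Q | (\max_a maxn (q a - q' a) (q' a - q a) <= k)%N]|
    <= (2 * k).+1 ^ n)%N.
Proof.
apply: card_ffun_diam => q1 q2; rewrite !inE.
move=> /andP[_ /bigmax_leqP q1k] /andP[_ /bigmax_leqP q2k] a.
by have := q1k a isT; have := q2k a isT; lia.
Qed.

(** Fix q. At most 3^n cells q' are at distance at most 1, and for them the single-hyperplane count
    is used. The others contribute a sum of inverse distances, bounded by [sum_inv_le]. The two
    parts account for 1 + 4 in the factor 5. *)
Lemma sum_overlap j m th d L (Q : {set {ffun 'I_n -> 'I_(mesh m th).+1}})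
    (w : {ffun 'I_n -> 'I_(mesh m th).+1} -> 'rV[R]_n)
    (A : {ffun 'I_n -> 'I_(mesh m th).+1} ->
      {set {ffun 'I_n -> 'I_(mesh m d).+1}}) :
  (2 <= n)%N -> 1 <= m -> 0 < th <= 1 -> (0 < L)%N -> (#|Q| <= (2 * L) ^ n)%N ->
  d = th / L%:R ^+ n.-1 ->
  (forall q, q \in Q -> [/\ slopes j (w q), box m (w q) & cell m th (w q) = q]) ->
  (forall q, q \in Q -> forall k, k \in A q -> hits (chart j (w q)) k) ->
  \sum_(q in Q) \sum_(q' in Q) (#|A q :&: A q'|%:R : R) <=
    #|Q|%:R * (5 * 3 ^+ n * overlap_const n m * d^-1 ^+ n.-1).
Proof.
move=> n2 m1 /andP[th0 th1] L0 QL dE Qw Aw.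
rewrite mulr_natl -sumr_const; apply: ler_sum => q qQ.
pose l (q' : {ffun 'I_n -> 'I_(mesh m th).+1}) :=
  (\max_a maxn (q a - q' a) (q' a - q a))%N.
have L0' : 1 <= L%:R :> R by rewrite ler1n.
have LX1 : 1 <= L%:R ^+ n.-1 :> R by rewrite exprn_ege1.
have d01 : 0 < d <= 1.
  rewrite dE divr_gt0 ?(lt_le_trans _ LX1) //= ler_pdivrMr ?(lt_le_trans _ LX1) //.
  by rewrite mul1r (le_trans th1).
have /andP[d0 d1] := d01.
have di0 : 0 < d^-1 by rewrite invr_gt0.
have XE (x : R) : x ^+ n.-1 = x * x ^+ n.-2.
  by rewrite -exprS prednK // -ltnS prednK // ltnW.
have nE' : n = n.-1.+1 by rewrite prednK // ltnW.
have co := @card_overlap j m d.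
have c3m : n.+1%:R * (3 * m) ^+ n.-1 <= overlap_const n m.
  rewrite /overlap_const ler_wpM2r //; first by rewrite exprn_ge0 //; lra.
  by rewrite -natrX -!natrM ler_nat -mulnn mulnA leq_pmull // !muln_gt0 (ltnW n2).
have c0 : 0 <= overlap_const n m.
  by rewrite /overlap_const !mulr_ge0 // exprn_ge0 //; lra.
move: (overlap_const n m) co c3m c0 => c co c3m c0.
have dX0 : 0 <= d^-1 ^+ n.-1 by rewrite exprn_ge0 // ltW.
have c3 : 0 <= 3 ^+ n * c * d^-1 ^+ n.-1.
  by apply: mulr_ge0 => //; apply: mulr_ge0 => //; rewrite exprn_ge0.
rewrite (bigID (fun q' => (l q' <= 1)%N)) /=.
have -> : 5 * 3 ^+ n * c * d^-1 ^+ n.-1 =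
  3 ^+ n * c * d^-1 ^+ n.-1 + 4 * (3 ^+ n * c * d^-1 ^+ n.-1).
  by ring.
apply: lerD.
  have near q' : q' \in Q ->
      #|A q :&: A q'|%:R <= c * d^-1 ^+ n.-1.
    move=> q'Q; have [sw' _ _] := Qw _ q'Q.
    have : (#|A q :&: A q'| <= n.+1 * (mesh m d).+1 ^ n.-1)%N.
      apply: (@card_hits1 _ _ j m d (normal j (w q')) (w q' 0 j)) => //.
        exact: normalj.
      by move=> k; rewrite inE => /andP[_]; exact: Aw.
    rewrite -(ler_nat R) natrM natrX => /le_trans; apply.
    apply: (@le_trans _ _ (n.+1%:R * ((3 * m) ^+ n.-1 * d^-1 ^+ n.-1))).
      rewrite ler_wpM2l // -exprMn lerXn2r ?nnegrE //; first by apply: mulr_ge0; lra.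
      exact: card_cells_le.
    by rewrite mulrA ler_wpM2r.
  apply: (@le_trans _ _ (\sum_(q' in Q | (l q' <= 1)%N)
      (c * d^-1 ^+ n.-1))).
    by apply: ler_sum => q' /andP[q'Q _]; exact: near.
  rewrite sumr_const -[leLHS]mulr_natl -mulrA ler_wpM2r ?mulr_ge0 //.
  rewrite -natrX ler_nat; apply: (leq_trans _ (card_near_le Q q 1)).
  by apply: eq_leq; apply: eq_card => q'; rewrite inE.
have far q' : q' \in Q -> (2 <= l q')%N ->
    #|A q :&: A q'|%:R <= 2 * c * d^-1 ^+ n.-2 / th * (l q')%:R^-1.
  move=> q'Q l2.
  have [sw wm wq] := Qw _ qQ; have [sw' w'm w'q] := Qw _ q'Q.
  have lr : 2 <= (l q')%:R :> R by rewrite ler_nat.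
  (* Parameters in cells at distance l >= 2 differ in some coordinate by more than th (l - 1), which
     is at least th l / 2. *)
  pose r := th * (l q')%:R / 2.
  have r0 : 0 < r by rewrite divr_gt0 // mulr_gt0 //; lra.
  apply: (@le_trans _ _ (c * d^-1 ^+ n.-2 / r)); last first.
    rewrite le_eqVlt; apply/orP; left; apply/eqP.
    rewrite /r !invfM invrK; move: (d^-1 ^+ n.-2) => z; ring.
  apply: (co (w q) (w q')) => //; last first.
    by move=> k; rewrite inE => /andP[kq kq']; split; apply: Aw; eauto.
  have rl : r <= th * (l q').-1%:R.
    rewrite /r -mulrA ler_pM2l //; move: lr.
    have -> : (l q')%:R = (l q').-1%:R + 1 :> R by rewrite natr1 prednK // ltnW.
    by lra.
  apply: contrapT => /forallNP N.
  suff : (l q' <= (l q').-1)%N by rewrite -ltnS prednK ?ltnn // ltnW.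
  have W a : `|w q 0 a - w q' 0 a| <= (l q').-1%:R * th.
    by rewrite mulrC ltW // (lt_le_trans _ rl) // ltNge; exact/negP/N.
  have Wq a : (q a <= q' a + (l q').-1)%N.
    rewrite -{1}wq -{1}w'q; apply: leq_cell => //.
    by apply: le_trans (ler_norm _) _.
  have Wq' a : (q' a <= q a + (l q').-1)%N.
    rewrite -{1}wq -{1}w'q; apply: leq_cell => //.
    by apply: le_trans (ler_norm _) _; rewrite distrC.
  by apply/bigmax_leqP => a _; rewrite geq_max !leq_subLR Wq Wq'.
apply: (@le_trans _ _ (\sum_(q' in Q | (2 <= l q')%N)
    (2 * c * d^-1 ^+ n.-2 / th * (l q')%:R^-1))).
  under eq_bigl do rewrite -ltnNge.
  by apply: ler_sum => q' /andP[q'Q l2]; exact: far.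
rewrite -mulr_sumr.
apply: (@le_trans _ _ (2 * c * d^-1 ^+ n.-2 / th *
    (2 * 3 ^+ n * L%:R ^+ n.-1))).
  apply: ler_wpM2l.
    apply: divr_ge0 (ltW th0); apply: mulr_ge0; last by rewrite exprn_ge0 // ltW.
    exact: mulr_ge0.
  (* As #|Q| <= (2L)^n, both terms of this bound are at most 3^n L^(n-1). *)
  have := @sum_inv_le R _ Q l n L n2 L0 (fun k _ => card_near_le Q q k).
  move=> /le_trans; apply; rewrite -[leRHS]mulrA [leRHS]mulr_natl mulr2n lerD2r.
  have L00 : 0 < L%:R :> R by lra.
  rewrite ler_pdivrMr // -mulrA -exprSr -nE' -exprMn.
  apply: (@le_trans _ _ ((2 * L) ^ n)%:R); first by rewrite ler_nat.
  by rewrite natrX natrM lerXn2r ?nnegrE ?mulr_ge0 // ler_wpM2r // ler_nat.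
(* The choice of d turns L^(n-1) / th into 1/d. *)
rewrite le_eqVlt; apply/orP; left; apply/eqP.
rewrite (XE d^-1) [in X in _ = 4 * (_ * (X * _))]dE.
rewrite invf_div; move: (d^-1 ^+ n.-2) (L%:R ^+ n.-1) (3 ^+ n) => x y z.
by ring.
Qed.

End Charts.

(** * Affine hyperplanes as points of a chart *)

Section Euclidean.
Context {R : realType} {n : nat}.
Implicit Types (x y u v w : 'rV[R]_n) (r c : R).

Lemma dotvC x y : dotv x y = dotv y x.
Proof. by apply: eq_bigr => a _; rewrite mulrC. Qed.

Lemma dotvDl x y u : dotv (x + y) u = dotv x u + dotv y u.
Proof. by rewrite -big_split; apply: eq_bigr => a _; rewrite !mxE mulrDl. Qed.

Lemma dotvZl c x u : dotv (c *: x) u = c * dotv x u.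
Proof. by rewrite /dotv mulr_sumr; apply: eq_bigr => a _; rewrite !mxE mulrA. Qed.

Lemma dotvv_ge_coord x a : x 0 a ^+ 2 <= dotv x x.
Proof.
rewrite /dotv (bigD1 a) //= -expr2 lerDl.
by apply: sumr_ge0 => b _; rewrite -expr2 sqr_ge0.
Qed.

Lemma coord_le_eucl_norm x a : `|x 0 a| <= eucl_norm x.
Proof. by rewrite -sqrtr_sqr ler_wsqrtr // dotvv_ge_coord. Qed.

Lemma eucl_norm_le x c : 0 <= c -> (forall a, `|x 0 a| <= c) ->
  eucl_norm x <= n%:R * c.
Proof.
move=> c0 xc; have nc0 : 0 <= n%:R * c by rewrite mulr_ge0.
rewrite -(ger0_norm nc0) -sqrtr_sqr ler_wsqrtr //.
apply: le_trans (ler_norm _) _; apply: le_trans (norm_dotv_le c0 c0 xc xc) _.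
rewrite exprMn -expr2 ler_wpM2r ?sqr_ge0 //.
by rewrite -natrX ler_nat -mulnn; case: (n) => // k; rewrite leq_pmulr.
Qed.

(** The projection and the translation are given by formulas in [w], so that both terms of
    [aplane_dist] can be estimated from the parameters. *)
Definition represents j w (P : @aplane R n n.-1) :=
  let u := normal j w in
  [/\ slopes j w,
      aplane_points P `<=` chart j w,
      forall x, orthoproj (direction P) x = x - (dotv x u / dotv u u) *: u
    & translation P = (w 0 j / dotv u u) *: u].

(** Take a nonzero vector orthogonal to the direction and divide it by its coordinate of largest
    modulus; the position of that coordinate is [j]. *)
Lemma exists_represents (P : @aplane R n n.-1) : (0 < n)%N ->
  exists j w, represents j w P.
Proof.
move=> n0; case: P => V t dV tV.
have dimT : (\dim {:'rV[R]_n} = n)%N by rewrite dimvf /dim /= mul1n.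
have [x xV] : exists x : 'rV[R]_n, x \notin V.
  apply: contrapT => /forallNP N.
  have : (fullv <= V)%VS.
    by apply/subvP => x _; apply/negPn/negP => xV; apply: (N x).
  by move=> /dimvS; rewrite dimT dV; case: (n) n0 => // k _; rewrite ltnn.
have [pV po] := orthoprojP V x.
set u0 := x - _ in po.
have u00 : u0 != 0.
  by apply: contra xV; rewrite subr_eq0 => /eqP ->.
have j0 : 'I_n by exact: Ordinal n0.
have [j _ jmax] : exists2 j, true & forall a, `|u0 0 a| <= `|u0 0 j|.
  case: (@arg_maxP _ _ _ j0 xpredT (fun a => `|u0 0 a|)) => // i _ iF.
  by exists i => // a; exact: iF.
have uj0 : 0 < `|u0 0 j|.
  rewrite lt_def normr_ge0 andbT; apply: contra u00 => /eqP uj.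
  apply/eqP/rowP => a; rewrite [RHS]mxE; apply/eqP; rewrite -normr_le0.
  by rewrite (le_trans (jmax a)) // uj.
pose u := (u0 0 j)^-1 *: u0.
have uV v : v \in V -> dotv u v = 0 by move=> vV; rewrite dotvZl po // mulr0.
have uj : u 0 j = 1 by rewrite mxE mulVf // -normr_gt0.
have uu : dotv u u != 0.
  by rewrite gt_eqF // (lt_le_trans _ (dotvv_ge_coord u j)) // uj expr1n.
have split y : exists2 v, v \in V & exists c, y = v + c *: u.
  have : y \in (V + <[u]>)%VS.
    suff -> : (V + <[u]>)%VS = fullv by rewrite memvf.
    apply/eqP; rewrite eqEdim subvf dimT dimv_disjoint_sum.
      rewrite dV dim_vline; have -> : u != 0.
        by apply: contra uu => /eqP ->; rewrite /dotv big1 // => a _; rewrite mxE mul0r.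
      by rewrite /= addn1 prednK.
    apply/eqP; rewrite -subv0; apply/subvP => z.
    rewrite memv_cap => /andP[zV /vlineP[c zE]].
    have : dotv u z = 0 by exact: uV.
    rewrite zE dotvC dotvZl => /eqP; rewrite mulf_eq0 (negPf uu) orbF => /eqP ->.
    by rewrite scale0r mem0v.
  by move=> /memv_addP[v vV [_ /vlineP[c ->] ->]]; exists v => //; exists c.
pose w : 'rV[R]_n := \row_a (if a == j then dotv t u else u 0 a).
have nE : normal j w = u.
  apply/rowP => a; rewrite [LHS]mxE.
  by have [->|aj] := eqVneq a j; rewrite ?uj // [LHS]mxE (negPf aj).
exists j, w; rewrite /represents nE /=; split.
- move=> a; rewrite nE mxE normrM normfV mulrC ler_pdivrMr // mul1r; exact: jmax.
- move=> _ [v vV <-]; rewrite /chart /hyper nE /= dotvDl dotvC uV // add0r.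
  by rewrite mxE eqxx.
- move=> y; have [v vV [c yE]] := split y.
  apply: (orthoproj_uniq (orthoprojP V y)); split.
    suff -> : y - (dotv y u / dotv u u) *: u = v by [].
    by rewrite {2}yE dotvDl dotvC uV // add0r dotvZl mulfK // yE addrK.
  by move=> z zV; rewrite opprB addrCA subrr addr0 dotvZl (uV z zV) mulr0.
- rewrite mxE eqxx; have [v vV [c tE]] := split t.
  have : dotv t v = 0 by exact: tV.
  rewrite tE dotvDl dotvZl uV // mulr0 addr0 => /dotvv_eq0 v0.
  by rewrite v0 add0r dotvZl mulfK.
Qed.

Lemma dist_ratio_le (y y' S S' r K s : R) : 1 <= S -> 1 <= S' ->
  `|y - y'| <= r -> `|y'| <= K -> `|S - S'| <= s ->
  `|y / S - y' / S'| <= r + K * s.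
Proof.
move=> S1 S'1 yr yK Ss.
have -> : y / S - y' / S' = (y - y') / S + y' * (S' - S) / (S * S').
  by field; apply/andP; split; lra.
have S0 : 0 < S by lra.
have SS0 : 1 <= S * S' by rewrite -[1]mulr1 ler_pM.
apply: le_trans (ler_normD _ _) _; apply: lerD; rewrite !normrM normfV.
  rewrite -[r]mulr1; apply: ler_pM => //.
  by rewrite invf_le1 ger0_norm //; lra.
rewrite -[K * s]mulr1; apply: ler_pM; rewrite ?mulr_ge0 ?invr_ge0 //.
  by apply: ler_pM => //; rewrite distrC.
by rewrite invf_le1 ger0_norm //; lra.
Qed.

(** The metric is Lipschitz in the parameters on a box: the formulas of [represents] are quotients
    with denominator [dotv u u >= 1]. Projections and translations take half of the bound each. Thus
    a parameter cell has diameter comparable to its side. *)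
Lemma aplane_dist_le j w w' m r (P P' : @aplane R n n.-1) :
  represents j w P -> represents j w' P' -> box m w -> box m w' -> 1 <= m ->
  (forall a, `|w 0 a - w' 0 a| <= r) ->
  aplane_dist P P' <= 8 * n%:R ^+ 3 * m * r.
Proof.
move=> [sw _ pw tw] [sw' _ pw' tw'] wm w'm m1 wr.
have r0 : 0 <= r by apply: le_trans (wr j); exact: normr_ge0.
rewrite /slopes in sw sw'; move: (normalj j w) (normalj j w').
set u := normal j w in sw pw tw *; set u' := normal j w' in sw' pw' tw' *.
move=> uj u'j; have ur a : `|u 0 a - u' 0 a| <= r.
  by rewrite !mxE; case: eqP => // _; rewrite subrr normr0.
clearbody u u'; have n1 : 1 <= n%:R :> R.
  by rewrite ler1n (leq_ltn_trans _ (ltn_ord j)).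
have S1 : 1 <= dotv u u.
  by rewrite (le_trans _ (dotvv_ge_coord u j)) // uj expr1n.
have S'1 : 1 <= dotv u' u'.
  by rewrite (le_trans _ (dotvv_ge_coord u' j)) // u'j expr1n.
have SS : `|dotv u u - dotv u' u'| <= 2 * n%:R * r.
  have -> : dotv u u - dotv u' u' = dotv (u - u') u + dotv (u - u') u'.
    by rewrite !dotvBl (dotvC u' u); ring.
  have ur' a : `|(u - u') 0 a| <= r by rewrite mxE [in X in _ + X]mxE.
  apply: le_trans (ler_normD _ _) _.
  have := norm_dotv_le r0 ler01 ur' sw; have := norm_dotv_le r0 ler01 ur' sw'.
  lra.
rewrite /aplane_dist.
have -> : 8 * n%:R ^+ 3 * m * r = 4 * n%:R ^+ 3 * m * r + 4 * n%:R ^+ 3 * m * r.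
  by ring.
have n3 : n%:R <= n%:R ^+ 3 :> R by rewrite -[leLHS]expr1 ler_weXn2l.
have n23 : n%:R ^+ 2 <= n%:R ^+ 3 :> R by rewrite ler_weXn2l.
have n0 : 0 <= n%:R :> R by [].
have mr : r <= m * r by rewrite ler_peMl.
apply: lerD.
  set A := [set _ | _ in _]; have ub : ubound A (4 * n%:R ^+ 3 * m * r).
    move=> _ [x x1 <-]; rewrite pw pw'.
    have x1' a : `|x 0 a| <= 1 by rewrite -x1 coord_le_eucl_norm.
    apply: (@le_trans _ _ (n%:R * (4 * n%:R ^+ 2 * r))).
      apply: eucl_norm_le => [|a].
        by rewrite mulr_ge0 // mulr_ge0 // exprn_ge0.
      rewrite !mxE.
      have -> : x 0 a - dotv x u / dotv u u * u 0 a -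
          (x 0 a - dotv x u' / dotv u' u' * u' 0 a) =
          dotv x u' * u' 0 a / dotv u' u' - dotv x u * u 0 a / dotv u u by ring.
      rewrite distrC.
      have := @dist_ratio_le (dotv x u * u 0 a) (dotv x u' * u' 0 a) _ _
        (n%:R * r + n%:R * r) n%:R _ S1 S'1 _ _ SS.
      move=> H; apply: le_trans (H _ _) _ => {H}.
      - have -> : dotv x u * u 0 a - dotv x u' * u' 0 a =
            dotv x (u - u') * u 0 a + dotv x u' * (u 0 a - u' 0 a).
          by rewrite dotvBr; ring.
        apply: le_trans (ler_normD _ _) _; rewrite !normrM; apply: lerD.
          rewrite -[leRHS]mulr1; apply: ler_pM => //.
          rewrite -[r]mul1r; apply: norm_dotv_le => // b.
          by rewrite mxE [in X in _ + X]mxE.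
        apply: ler_pM => //; rewrite -[n%:R]mulr1 -[X in _ * X]mulr1.
        exact: norm_dotv_le.
      - rewrite normrM -[leRHS]mulr1; apply: ler_pM => //.
        rewrite -[n%:R]mulr1 -[X in _ * X]mulr1; exact: norm_dotv_le.
      have : n%:R * r <= n%:R ^+ 2 * r.
        by rewrite ler_wpM2r // -[leLHS]expr1 ler_weXn2l.
      lra.
    have -> : n%:R * (4 * n%:R ^+ 2 * r) = 4 * n%:R ^+ 3 * r by ring.
    rewrite -[leRHS]mulrA; apply: ler_wpM2l mr.
    by rewrite mulr_ge0 // exprn_ge0.
  have [->|/set0P[z Az]] := eqVneq A set0; last first.
    by apply: ge_sup => //; exists z.
  by rewrite sup0 !mulr_ge0 ?exprn_ge0 //; lra.
rewrite tw tw'.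
apply: (@le_trans _ _ (n%:R * (4 * n%:R * m * r))).
  apply: eucl_norm_le => [|a]; first by rewrite !mulr_ge0 //; lra.
  rewrite !mxE ![_ / _ * _]mulrAC.
  have := @dist_ratio_le (w 0 j * u 0 a) (w' 0 j * u' 0 a) _ _
     (r + m * r) m _ S1 S'1 _ _ SS.
  move=> H; apply: le_trans (H _ _) _ => {H}.
  - have -> : w 0 j * u 0 a - w' 0 j * u' 0 a =
        (w 0 j - w' 0 j) * u 0 a + w' 0 j * (u 0 a - u' 0 a) by ring.
    apply: le_trans (ler_normD _ _) _; rewrite !normrM; apply: lerD.
      by rewrite -[leRHS]mulr1; apply: ler_pM.
    by apply: ler_pM => //; exact: w'm.
  - by rewrite normrM -[leRHS]mulr1; apply: ler_pM => //; exact: w'm.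
  have : m * r <= n%:R * (m * r) by rewrite ler_peMl // (le_trans r0).
  lra.
have -> : n%:R * (4 * n%:R * m * r) = 4 * n%:R ^+ 2 * m * r by ring.
have mr0 : 0 <= m * r by exact: (le_trans r0).
by rewrite -mulrA -[leRHS]mulrA; apply: ler_wpM2r => //; rewrite ler_pM2l.
Qed.

End Euclidean.

(** * Upper limits at 0, countable stability and covering numbers *)

Section Dimension.
Context {R : realType}.
Implicit Types (v : \bar R) (f : R -> \bar R).

Lemma limf_esup_at_right0_ge f v :
  (forall e : R, 0 < e -> exists2 d, 0 < d < e & (v <= f d)%E) ->
  (v <= limf_esup f (0 : R)^'+)%E.
Proof.
move=> fv; apply: le_ereal_inf_tmp => _ [V FV <-].
have [e /= e0 eV] := FV; have [d /andP[d0 de] vd] := fv e e0.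
apply: le_trans vd _; apply: ereal_sup_ubound; exists d => //.
by apply: eV => //=; rewrite sub0r normrN gtr0_norm.
Qed.

Lemma limf_esup_at_right0_gt f v : (v < limf_esup f (0 : R)^'+)%E ->
  forall e : R, 0 < e -> exists2 d, 0 < d < e & (v < f d)%E.
Proof.
move=> vf e e0; pose V := [set d : R | 0 < d < e].
have FV : (0 : R)^'+ V.
  near=> d; apply/andP; split; near: d.
    exact: nbhs_right_gt.
  exact: nbhs_right_lt.
have : (v < ereal_sup (f @` V))%E.
  by apply: lt_le_trans vf _; apply: ereal_inf_lbound; exists V.
by move=> /ereal_sup_gt[_ [d Vd <-] vd]; exists d.
Unshelve. all: by end_near. Qed.

(** Otherwise the pieces themselves would be a cover showing that the packing dimension is at most
    v. *)
Lemma packing_dim_piece (T : Type) (dist : T -> T -> R) (A : set T)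
    (I : countType) (i0 : I) (W : I -> set T) v :
  A `<=` \bigcup_i W i -> (v < packing_dim dist A)%E ->
  exists i, (v < upper_box_dim dist (W i))%E.
Proof.
move=> AW; apply: contraPP => /forallNP H.
apply/negP; rewrite -leNgt.
(* Naturals that encode no index repeat the piece [W i0]. *)
pose U n := W (odflt i0 (unpickle n)).
apply: le_trans (_ : (ereal_sup (range (fun n => upper_box_dim dist (U n))) <= v)%E).
  apply: ereal_inf_lbound; exists U => // x /AW[i _ Wx].
  by exists (pickle i) => //; rewrite /U pickleK.
by apply: ge_ereal_sup => _ [n _ <-]; rewrite leNgt; exact/negP/H.
Qed.

Lemma diam_le (T : Type) (dist : T -> T -> R) (U : set T) r :
  (forall x y, U x -> U y -> dist x y <= r) -> (diam dist U <= r%:E)%E.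
Proof.
by move=> Ur; apply: ge_ereal_sup => _ [x Ux [y Uy <-]]; rewrite lee_fin Ur.
Qed.

Lemma dist_le_of_diam (T : Type) (dist : T -> T -> R) (U : set T) r x y :
  (diam dist U <= r%:E)%E -> U x -> U y -> dist x y <= r.
Proof.
move=> Ur Ux Uy; rewrite -lee_fin; apply: le_trans Ur.
by apply: ereal_sup_ubound; exists x => //; exists y.
Qed.

Lemma covering_number_le (T : Type) (dist : T -> T -> R) (A : set T) r
    (I : finType) (W : I -> set T) (Q : {set I}) :
  A `<=` \bigcup_(i in [set` Q]) W i ->
  (forall i x y, W i x -> W i y -> dist x y <= r) ->
  (covering_number dist r A <= #|Q|%:R%:E)%E.
Proof.
move=> AW Wr; apply: ereal_inf_lbound; exists #|Q| => //.
exists (fun i : 'I_#|Q| => W (enum_val i)); split; last first.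
  by move=> i; apply: diam_le => x y; exact: Wr.
move=> x /AW[i /= iQ Wx]; exists (enum_rank_in iQ i) => //.
by rewrite enum_rankK_in.
Qed.

End Dimension.

(** * Cell counts against covering numbers and Hausdorff measure *)

Section CellCounts.
Context {R : realType} {n : nat}.
Implicit Types (x y : 'rV[R]_n) (E : set 'rV[R]_n) (m d s : R).

Definition cells m d E : {set {ffun 'I_n -> 'I_(mesh m d).+1}} :=
  finset (fun k => `[< hits E k >]).

Lemma mem_cells m d E k : k \in cells m d E <-> hits E k.
Proof. by rewrite inE; split=> [/asboolP|/asboolP]. Qed.

(** Points at distance at most d have cell indices differing by at most 1 in each coordinate, so a
    set of diameter at most d meets at most 2^n cells. *)
Lemma card_cells_cover m d E k (U : 'I_k -> set 'rV[R]_n) : 0 < d ->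
  E `<=` \bigcup_i U i -> (forall i, (diam (@eucl_dist R n) (U i) <= d%:E)%E) ->
  (#|cells m d E| <= k * 2 ^ n)%N.
Proof.
move=> d0 EU Ud; pose W := (\bigcup_(i in 'I_k) cells m d (E `&` U i))%SET.
apply: (@leq_trans #|W|).
  apply/subset_leq_card/fintype.subsetP => c /mem_cells[x [mx Ex xc]].
  have [i _ Uix] := EU _ Ex; apply/bigcupP; exists i => //.
  by apply/mem_cells; exists x.
have -> : (k * 2 ^ n = \sum_(i < k) 2 ^ n)%N by rewrite sum_nat_const card_ord.
apply: (@leq_trans (\sum_(i in 'I_k) #|cells m d (E `&` U i)|)).
  rewrite /W; elim/big_rec2 : _ => [|i a c _ ac]; first by rewrite cards0.
  by apply: leq_trans (leq_card_setU _ _) _; rewrite leq_add2l.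
apply: leq_sum => i _; apply: card_ffun_diam => c c' /mem_cells[x [mx [_ Ux] <-]].
move=> /mem_cells[y [my [_ Uy] <-]] a; apply: leq_cell => //.
rewrite mul1r; apply: le_trans (dist_le_of_diam (Ud i) Ux Uy).
apply: le_trans (ler_norm _) _.
by have := coord_le_eucl_norm (x - y) a; rewrite !mxE.
Qed.

Lemma covering_number_ge m d E : 0 < d ->
  ((#|cells m d E|%:R / 2 ^+ n)%:E <= covering_number (@eucl_dist R n) d E)%E.
Proof.
move=> d0; apply: le_ereal_inf_tmp => _ [k [U [EU Ud]] <-].
rewrite lee_fin ler_pdivrMr ?exprn_gt0 //.
by rewrite -natrX -natrM ler_nat; exact: (card_cells_cover m d0 EU Ud).
Qed.

Lemma cell_eq_dist m d x y : 0 < d -> box m x -> box m y ->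
  cell m d x = cell m d y -> eucl_dist x y <= n%:R * d.
Proof.
move=> d0 mx my E; apply: eucl_norm_le; first exact: ltW.
by move=> a; rewrite !mxE; apply: (@cell_eq_le _ _ m) => //; rewrite E.
Qed.

Lemma eucl_distxx x : eucl_dist x x = 0.
Proof.
by rewrite /eucl_dist subrr /eucl_norm /dotv big1 ?sqrtr0 // => a _; rewrite mxE mul0r.
Qed.

Lemma nneseries_pred1 (p : nat) (c : \bar R) : (0 <= c)%E ->
  (\sum_(0 <= i <oo) (if i == p then c else 0) = c)%E.
Proof.
move=> c0; rewrite (@nneseriesD1 _ _ p) //; last by move=> k _; case: ifP.
rewrite eqxx eseries0 ?adde0 // => k _ /=; by case: eqP.
Qed.

(** Each piece is cut into its cells at a scale of its own, chosen so that piece [a] costs at most e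
    / 2^(a+1). *)
Lemma hausdorff_content_le0 s r A (B : nat -> set 'rV[R]_n) (m : nat -> R) :
  (0 < n)%N -> 0 < s -> 0 < r -> A `<=` \bigcup_a B a ->
  (forall a, B a `<=` box (m a)) ->
  (forall a c, 0 < c ->
    exists2 d, 0 < d & #|cells (m a) d (B a)|%:R * d `^ s < c) ->
  (hausdorff_content (@eucl_dist R n) s r A <= 0)%E.
Proof.
move=> n0 s0 r0 AB Bm small; apply/lee_addgt0Pr => e e0; rewrite add0e.
have n0' : 0 < n%:R :> R by rewrite ltr0n.
(* The first bound controls the cost. The second gives n d <= r, because a nonempty piece meets at
   least one cell. *)
pose c a := Num.min (e / (2 ^ a.+1)%:R / n%:R `^ s) ((r / n%:R) `^ s).
have c0 a : 0 < c a.
  by rewrite /c lt_min !powR_gt0 ?divr_gt0 // ?powR_gt0 // ltr0n expn_gt0.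
have /choice[dd ddP] a : exists d, 0 < d /\ #|cells (m a) d (B a)|%:R * d `^ s < c a.
  by have [d] := small a _ (c0 a); exists d.
(* The cell is encoded first, since its type depends on [a]. Codes that do not occur give an empty
   [U p]. *)
pose idx a x := pickle (a, pickle (cell (m a) (dd a) x)).
pose U p := [set x | exists a, B a x /\ p = idx a x].
have idx_inj a a' x x' : idx a x = idx a' x' ->
    a = a' /\ cell (m a) (dd a) x = cell (m a) (dd a) x'.
  move=> /(pcan_inj pickleK)[aa']; rewrite -aa' => E; split=> //.
  exact: (pcan_inj pickleK E).
have ddr a x : B a x -> n%:R * dd a <= r.
  move=> Bx; have [d0 dc] := ddP a; rewrite leNgt; apply/negP => rd.
  have : (r / n%:R) `^ s <= dd a `^ s.
    rewrite ge0_ler_powR ?nnegrE ?divr_ge0 ?(ltW s0) ?(ltW r0) ?(ltW d0) //.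
    by rewrite ler_pdivrMr // mulrC ltW.
  apply/negP; rewrite -ltNge.
  apply: (@le_lt_trans _ _ (#|cells (m a) (dd a) (B a)|%:R * dd a `^ s)).
    rewrite ler_peMl ?powR_ge0 // ler1n; apply/card_gt0P.
    exists (cell (m a) (dd a) x); apply/mem_cells; exists x; split=> //.
    exact: Bm.
  by apply: lt_le_trans dc _; rewrite /c ge_min lexx orbT.
have Ud a x y : B a x -> U (idx a x) y ->
    B a y /\ cell (m a) (dd a) x = cell (m a) (dd a) y.
  by move=> Bx [a' [By /idx_inj[aa' E]]]; move: By; rewrite -aa'.
have Udiam a x : B a x ->
    (diam (@eucl_dist R n) (U (idx a x)) <= (n%:R * dd a)%:E)%E.
  move=> Bx; apply: diam_le => y z /(Ud _ _ _ Bx)[By yx] /(Ud _ _ _ Bx)[Bz zx].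
  apply: (@cell_eq_dist (m a)); rewrite -?yx //; try exact: Bm.
  by have [] := ddP a.
pose k a : \bar R := ((n%:R * dd a) `^ s)%:E.
have k0 a : (0 <= k a)%E by rewrite lee_fin powR_ge0.
(* The cost of each cell of piece [a], placed at its code p; the double series can then be summed
   over p first. *)
pose h p a : \bar R :=
  (\sum_(q in cells (m a) (dd a) (B a))
    if p == pickle (a, pickle q) then k a else 0)%E.
have h0 p a : (0 <= h p a)%E by apply: sume_ge0 => q _; case: ifP.
apply: (@le_trans _ _ (\sum_(0 <= p <oo) \sum_(0 <= a <oo) h p a)%E).
  apply: (@le_trans _ _
      (\sum_(0 <= i <oo | U i != set0) diam (@eucl_dist R n) (U i) `^ s)%E).
    apply: ereal_inf_lbound; exists U => //; split.
      by move=> x /AB[a _ Bx]; exists (idx a x) => //; exists a.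
    move=> p; have [->|/set0P[x [a [Bx ->]]]] := eqVneq (U p) set0.
      by apply: diam_le.
    by apply: le_trans (Udiam _ _ Bx) _; rewrite lee_fin (ddr _ _ Bx).
  rewrite eseries_mkcond; apply: lee_nneseries => [p _ _|p _].
    by case: ifP => // _; exact: poweR_ge0.
  case: ifP => [/set0P[x [a [Bx pE]]]|_]; last by apply: nneseries_ge0.
  rewrite (@nneseriesD1 _ _ a) //; apply: (@le_trans _ _ (h p a)); last first.
    by rewrite leeDl // nneseries_ge0.
  have xc : cell (m a) (dd a) x \in cells (m a) (dd a) (B a).
    by apply/mem_cells; exists x; split=> //; exact: Bm.
  rewrite /h (bigD1 _ xc) /= pE eqxx; apply: (@le_trans _ _ (k a)); last first.
    by rewrite leeDl //; apply: sume_ge0 => q _; case: ifP.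
  have [d0 _] := ddP a.
  rewrite /k -poweR_EFin; apply: gt0_ler_poweR; rewrite ?(ltW s0) //.
  - rewrite in_itv /= leey andbT; apply: ereal_sup_ubound.
    by exists x; [exists a|exists x; [exists a|rewrite eucl_distxx]].
  - by rewrite in_itv /= leey andbT lee_fin mulr_ge0 // ltW.
  - exact: Udiam.
rewrite nneseries_interchange //.
apply: le_trans (@epsilon_trick0 R e xpredT (ltW e0)).
apply: lee_nneseries => [a _ _|a _]; first by apply: nneseries_ge0.
rewrite /h nneseries_sum; last by move=> q p _; case: ifP.
under eq_bigr do rewrite nneseries_pred1 //.
have [d0 dc] := ddP a.
rewrite sumEFin lee_fin sumr_const -[leLHS]mulr_natl powRM ?(ltW d0) //.
rewrite mulrCA mulrC -ler_pdivlMr ?powR_gt0 //.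
by apply: ltW; apply: lt_le_trans dc _; rewrite /c ge_min lexx.
Qed.

Lemma hausdorff_measure_eq0 s A (B : nat -> set 'rV[R]_n) (m : nat -> R) :
  (0 < n)%N -> 0 < s -> A `<=` \bigcup_a B a ->
  (forall a, B a `<=` box (m a)) ->
  (forall a c, 0 < c ->
    exists2 d, 0 < d & #|cells (m a) d (B a)|%:R * d `^ s < c) ->
  hausdorff_measure (@eucl_dist R n) s A = 0%E.
Proof.
move=> n0 s0 AB Bm small; apply/eqP; rewrite eq_le; apply/andP; split.
  apply: ge_ereal_sup => _ [r r0 <-].
  exact: (@hausdorff_content_le0 s r A B m).
apply: (@le_trans _ _ (hausdorff_content (@eucl_dist R n) s 1 A)); last first.
  by apply: ereal_sup_ubound; exists 1 => //=.
apply: le_ereal_inf_tmp => _ [U _ <-]; apply: nneseries_ge0 => p _ _.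
exact: poweR_ge0.
Qed.

End CellCounts.

(** * The counting argument for a localised family *)

Lemma nat_root_exists n M : (0 < n)%N -> (0 < M)%N ->
  exists L, [/\ (0 < L)%N, (L ^ n <= M)%N & (M <= (2 * L) ^ n)%N].
Proof.
move=> n0 M0.
have exP : exists L, (0 < L)%N && (L ^ n <= M)%N by exists 1%N; rewrite exp1n.
have ubP L : (0 < L)%N && (L ^ n <= M)%N -> (L <= M)%N.
  move=> /andP[L0 LM]; apply: leq_trans LM; rewrite -{1}[L]expn1.
  exact: leq_pexp2l.
case: (ex_maxnP exP ubP) => L /andP[L0 LM] Lmax; exists L; split=> //.
(* The maximal L is the integer part of the n-th root of M, and L + 1 <= 2L. *)
have [SM|/ltnW MS] := leqP (L.+1 ^ n) M.
  by have := Lmax L.+1 SM; rewrite ltnn.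
by apply: leq_trans MS _; rewrite leq_exp2r // mul2n -addnn -addn1 leq_add2l.
Qed.

Section Main.
Context {R : realType} {n : nat}.
Implicit Types (m d s th t r : R).

(** By Cauchy-Schwarz, (#|Q| c)^2 is at most the number of cells of F times the total overlap, which
    [sum_overlap] bounds linearly in #|Q|. *)
Lemma card_cells_piece j m th d (c : R) L
    (Q : {set {ffun 'I_n -> 'I_(mesh m th).+1}})
    (w : {ffun 'I_n -> 'I_(mesh m th).+1} -> 'rV[R]_n)
    (S : {ffun 'I_n -> 'I_(mesh m th).+1} -> set 'rV[R]_n) (F : set 'rV[R]_n) :
  (2 <= n)%N -> 1 <= m -> 0 < th <= 1 -> (0 < L)%N -> (#|Q| <= (2 * L) ^ n)%N ->
  d = th / L%:R ^+ n.-1 -> 0 <= c ->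
  (forall q, q \in Q ->
    [/\ slopes j (w q), box m (w q) & cell m th (w q) = q]) ->
  (forall q, q \in Q -> S q `<=` chart j (w q)) ->
  (forall q, q \in Q -> c <= #|cells m d (S q `&` F)|%:R) ->
  #|Q|%:R * c ^+ 2 <=
    #|cells m d F|%:R * (5 * 3 ^+ n * overlap_const n m * d^-1 ^+ n.-1).
Proof.
move=> n2 m1 th01 L0 QL dE c0 Qw Sw Sc.
set X := 5 * _ * _ * _.
pose A q := cells m d (S q `&` F).
have AX : \sum_(q in Q) \sum_(q' in Q) (#|A q :&: A q'|%:R : R) <= #|Q|%:R * X.
  apply: (@sum_overlap _ _ j m th d L Q w A) => // q qQ k /mem_cells[x [mx [Sx _] xk]].
  by exists x; split=> //; exact: (Sw q).
have [Q0|Q0] := posnP #|Q|.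
  rewrite Q0 mul0r; apply: mulr_ge0 => //.
  have /andP[th0 _] := th01.
  rewrite /X !mulr_ge0 ?exprn_ge0 ?invr_ge0 ?dE ?divr_ge0 ?exprn_ge0 ?(ltW th0) //.
  lra.
have CS := cauchy_schwarz_bigcup Q A.
have {}AX : (\sum_(q in Q) \sum_(q' in Q) #|A q :&: A q'|)%N%:R <= #|Q|%:R * X.
  by rewrite natr_sum; under eq_bigr do rewrite natr_sum.
rewrite -(ler_nat R) natrM natrX natr_sum in CS.
have AN : (#|\bigcup_(q in Q) A q|%SET <= #|cells m d F|)%N.
  apply/subset_leq_card/bigcupsP => q _; apply/fintype.subsetP => k.
  move=> /mem_cells[x [mx [_ Fx] xk]].
  by apply/mem_cells; exists x.
have QcA : #|Q|%:R * c <= \sum_(q in Q) (#|A q|%:R : R).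
  by rewrite mulr_natl -sumr_const; apply: ler_sum => q /Sc.
have Q0' : 0 < #|Q|%:R :> R by rewrite ltr0n.
rewrite -(ler_pM2l Q0') mulrA -expr2 -exprMn.
apply: (@le_trans _ _ ((\sum_(q in Q) #|A q|%:R) ^+ 2)).
  by rewrite lerXn2r ?nnegrE ?sumr_ge0 // mulr_ge0.
apply: (le_trans CS); rewrite [leRHS]mulrCA; apply: ler_pM => //.
by rewrite ler_nat.
Qed.

(** With M occupied parameter cells, [card_cells_piece] gives about M d^(n-1-2s) cells of F, and M
    is at least about d^(-t'), where 1/t' = 1/t + (n-1)/n. *)
Lemma piece_upper_box_dim j m s t (c : nat) (PQ : set (@aplane R n n.-1))
    (P' : @aplane R n n.-1 -> set 'rV[R]_n) (F : set 'rV[R]_n) :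
  (2 <= n)%N -> 1 <= m -> 0 < t ->
  (forall P, PQ P -> P' P `<=` aplane_points P) ->
  (forall P, PQ P -> exists w, represents j w P /\ box m w) ->
  (forall P, PQ P -> forall d, 0 < d <= 1 ->
    d `^ (- s) / c.+1%:R <= #|cells m d (P' P `&` F)|%:R) ->
  (t%:E < upper_box_dim (@aplane_dist R n n.-1) PQ)%E ->
  ((2 * s - (n%:R - 1) + n%:R * t / ((n%:R - 1) * t + n%:R))%:E <=
    upper_box_dim (@eucl_dist R n) F)%E.
Proof.
move=> n2 m1 t0 P'P PQw PQc tPQ.
set t' := n%:R * t / _; set v := (X in (X%:E <= _)%E).
have n1 : 1 < n%:R :> R by rewrite ltr1n.
have n1E : n.-1%:R = n%:R - 1 :> R by rewrite -subn1 natrB // ltnW.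
have oc0 : 0 < overlap_const n m :> R.
  by rewrite /overlap_const !mulr_gt0 ?exprn_gt0 //; lra.
pose X : R := 5 * 3 ^+ n * overlap_const n m.
have X0 : 0 < X by rewrite /X mulr_gt0 // mulr_gt0 // exprn_gt0.
pose C : R := 8 * n%:R ^+ 3 * m.
have C1 : 1 <= C.
  by rewrite /C -natrX -natrM mulr_ege1 // ler1n muln_gt0 expn_gt0 (ltnW n2).
have C0 : 0 < C by lra.
have c0 : 0 < c.+1%:R :> R by rewrite ltr0n.
apply/lee_addgt0Pr => eta eta0; rewrite -leeBlDr // -EFinB.
apply: limf_esup_at_right0_ge => e e0.
(* All constants that survive after taking logarithms; the bound on r makes them at most eta (- ln
   d). *)
pose K : R := t' * ln C + ln (c.+1%:R ^+ 2 * X * 2 ^+ n).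
pose r0 : R := Num.min e (Num.min 1 (expR (- (K / eta)))).
have r00 : 0 < r0 by rewrite !lt_min e0 ltr01 expR_gt0.
have [r /andP[rp]] := limf_esup_at_right0_gt tPQ r00.
rewrite !lt_min => /andP[re /andP[r1 rK]] tr.
(* By [aplane_dist_le], planes with parameters in one cell of side th are at distance at most r, so
   the occupied cells number at least the covering number at scale r. *)
pose th := r / C.
have th0 : 0 < th by exact: divr_gt0.
have thr : th <= r by rewrite ler_pdivrMr // ler_peMr // ltW.
have th01 : 0 < th <= 1 by rewrite th0 (le_trans thr) // ltW.
pose W q := [set P | PQ P /\
  exists w, [/\ represents j w P, box m w & cell m th w = q]].
pose Q := finset (fun q => `[< W q !=set0 >]).
have QW q : q \in Q -> W q !=set0 by rewrite inE => /asboolP.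
have covQ : (covering_number (@aplane_dist R n n.-1) r PQ <= #|Q|%:R%:E)%E.
  apply: (@covering_number_le _ _ _ _ _ _ W) => [P PP|q P P1].
    have [w [wP mw]] := PQw _ PP; exists (cell m th w) => /=.
      by rewrite inE; apply/asboolP; exists P; split=> //; exists w.
    by split=> //; exists w.
  move=> [_ [w [wP mw wq]]] [_ [w1 [wP1 mw1 wq1]]].
  have -> : r = C * th by rewrite mulrC divfK // gt_eqF.
  apply: (aplane_dist_le wP wP1) => // a.
  by apply: (@cell_eq_le _ _ m) => //; rewrite wq wq1.
have lr0 : 0 < - ln r by rewrite oppr_gt0 ln_lt0 // rp.
have tM : t * (- ln r) < ln #|Q|%:R /\ (0 < #|Q|)%N.
  have : (t%:E * (- ln r)%:E < lne (#|Q|%:R%:E : \bar R))%E.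
    apply: (@lt_le_trans _ _ (lne (covering_number (@aplane_dist R n n.-1) r PQ))).
      by move: tr; rewrite inver (gt_eqF lr0) lte_pdivlMr.
    rewrite lee_lne // in_itv /= leey andbT ?lee_fin //.
    by apply: le_ereal_inf_tmp => _ [k _ <-]; rewrite lee_fin.
  have [->|Q0] := posnP #|Q|; first by rewrite /= lexx ltNge leNye.
  by rewrite lne_EFin ?ltr0n // -EFinM lte_fin.
have [{}tM M0] := tM.
have [L [L0 LM ML]] := nat_root_exists (ltnW n2) M0.
pose d := th / L%:R ^+ n.-1.
have L1 : 1 <= L%:R :> R by rewrite ler1n.
have L0' : 0 < L%:R :> R by rewrite ltr0n.
have LX1 : 1 <= L%:R ^+ n.-1 :> R by rewrite exprn_ege1.
have LX0 : 0 < L%:R ^+ n.-1 :> R by rewrite exprn_gt0.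
have d0 : 0 < d by exact: divr_gt0.
have dth : d <= th by rewrite ler_pdivrMr // ler_peMr // ltW.
have dr : d <= r by exact: le_trans thr.
have d1 : d <= 1 by rewrite (le_trans dr) // ltW.
exists d; first by rewrite d0 (le_lt_trans dr).
have [q0 q0Q] : exists q, q \in Q by apply/card_gt0P.
have [P0 [PP0 [w0 _]]] := QW _ q0Q.
(* One plane per occupied cell; the other cells receive a default. *)
have /choice[wP wPP] q : exists wP : 'rV[R]_n * @aplane R n n.-1, q \in Q ->
    [/\ PQ wP.2, represents j wP.1 wP.2, box m wP.1 & cell m th wP.1 = q].
  have [/QW[P [PP [w [H1 H2 H3]]]]|qQ] := boolP (q \in Q).
    by exists (w, P).
  by exists (w0, P0).
have main : #|Q|%:R * (d `^ (- s) / c.+1%:R) ^+ 2 <=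
    #|cells m d F|%:R * (X * d^-1 ^+ n.-1).
  apply: (@card_cells_piece j m th d _ L Q (fun q => (wP q).1)
    (fun q => P' (wP q).2) F)
    => // [|q /wPP[_ [sw _ _ _] ? ?] //|q /wPP[PP [_ Pw _ _] _ _]|
      q /wPP[PP _ _ _]].
  - by rewrite divr_ge0 ?powR_ge0.
  - by apply: subset_trans Pw; exact: P'P.
  - by apply: PQc => //; rewrite d0.
pose l := - ln d.
have lE : ln d^-1 = l by rewrite lnV ?posrE.
have rl : - ln r <= l by rewrite lerN2 ler_ln ?posrE.
have l0 : 0 < l by exact: lt_le_trans rl.
have Kl : K <= eta * l.
  have : K / eta < - ln r.
    by rewrite ltrNr -ltr_expR lnK ?posrE.
  rewrite ltr_pdivrMr // mulrC => /ltW /le_trans; apply.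
  by rewrite ler_pM2l.
have M0' : 0 < #|Q|%:R :> R by rewrite ltr0n.
have lhs0 : 0 < #|Q|%:R * (d `^ (- s) / c.+1%:R) ^+ 2.
  by rewrite mulr_gt0 // exprn_gt0 // divr_gt0 // powR_gt0.
have dX0 : 0 < d^-1 ^+ n.-1 by rewrite exprn_gt0 // invr_gt0.
have N0 : 0 < #|cells m d F|%:R :> R.
  have := lt_le_trans lhs0 main; rewrite pmulr_lgt0 //; exact: mulr_gt0.
have lnmain : ln #|Q|%:R + 2 * (s * l) - ln (c.+1%:R ^+ 2 * X) <=
    ln #|cells m d F|%:R + (n%:R - 1) * l.
  set a := d `^ (- s) / _ in main.
  have a0 : 0 < a by rewrite divr_gt0 // powR_gt0.
  have la : ln a = s * l - ln c.+1%:R.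
    by rewrite ln_div ?posrE ?powR_gt0 // ln_powR /l; ring.
  have lQ : ln (#|Q|%:R * a ^+ 2) = ln #|Q|%:R + 2 * ln a.
    by rewrite lnM ?posrE ?exprn_gt0 // (lnXn 2 a0) mulr_natl.
  have lX : ln (c.+1%:R ^+ 2 * X) = 2 * ln c.+1%:R + ln X.
    by rewrite lnM ?posrE ?exprn_gt0 // (lnXn 2 c0) mulr_natl.
  have lN : ln (#|cells m d F|%:R * (X * d^-1 ^+ n.-1)) =
      ln #|cells m d F|%:R + (ln X + (n%:R - 1) * l).
    rewrite lnM ?posrE ?(mulr_gt0 X0 dX0) // lnM ?posrE // lnXn ?invr_gt0 // lE.
    by rewrite -n1E mulr_natl.
  have : ln (#|Q|%:R * a ^+ 2) <= ln (#|cells m d F|%:R * (X * d^-1 ^+ n.-1)).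
    by rewrite ler_ln ?posrE //; apply: mulr_gt0 => //; exact: mulr_gt0.
  by rewrite lQ lN lX la; lra.
(* Here l - ln C = - ln r + (n-1) ln L, with t (- ln r) < ln M and n ln L <= ln M. *)
have lnM' : t' * (l - ln C) <= ln #|Q|%:R.
  have lM : n%:R * ln L%:R <= ln #|Q|%:R :> R.
    rewrite mulr_natl -lnXn ?posrE // ler_ln ?posrE ?exprn_gt0 //.
    by rewrite -natrX ler_nat.
  have -> : l = - ln r + ln C + (n%:R - 1) * ln L%:R.
    rewrite /l /d /th !ln_div ?posrE ?divr_gt0 // lnXn ?posrE //.
    by rewrite -[_ *+ n.-1]mulr_natl n1E; lra.
  have den : 0 < (n%:R - 1) * t + n%:R by nra.
  rewrite /t' mulrAC ler_pdivrMr //.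
  have : n%:R * (t * - ln r) <= n%:R * ln #|Q|%:R by rewrite ler_pM2l ?ltW //; lra.
  have : (n%:R - 1) * t * (n%:R * ln L%:R) <= (n%:R - 1) * t * ln #|Q|%:R.
    by rewrite ler_wpM2l // mulr_ge0 //; lra.
  lra.
rewrite -/l inver (gt_eqF l0) lee_pdivlMr // -EFinM.
apply: (@le_trans _ _ (lne (#|cells m d F|%:R / 2 ^+ n)%:E)); last first.
  rewrite lee_lne ?covering_number_ge // in_itv /= leey andbT.
    by rewrite lee_fin divr_ge0 // exprn_ge0.
  by apply: le_ereal_inf_tmp => _ [k _ <-]; rewrite lee_fin.
have N2 : 0 < #|cells m d F|%:R / 2 ^+ n :> R by rewrite divr_gt0 ?exprn_gt0.
rewrite lne_EFin // lee_fin ln_div ?posrE ?exprn_gt0 //.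
have : K = t' * ln C + (ln (c.+1%:R ^+ 2 * X) + ln (2 ^+ n)).
  rewrite /K lnM ?posrE ?exprn_gt0 //.
  by apply: mulr_gt0 => //; exact: exprn_gt0.
rewrite /v -/l; lra.
Qed.

(** If every choice failed, each piece of [A] in a box would have cell counts with arbitrarily small
    cost at exponent s, and [hausdorff_measure_eq0] would apply. The bound r lets the same box also
    hold the parameter of a plane. *)
Lemma exists_piece (A : set 'rV[R]_n) (U : nat -> set 'rV[R]_n) s r :
  (0 < n)%N -> 0 < s -> A `<=` \bigcup_i U i ->
  hausdorff_measure (@eucl_dist R n) s A <> 0%E ->
  exists i k c : nat, r <= k.+1%:R /\ forall d, 0 < d <= 1 ->
    d `^ (- s) / c.+1%:R <= #|cells k.+1%:R d (A `&` U i)|%:R.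
Proof.
move=> n0 s0 AU; apply: contra_notP => N.
(* Shifting all box sizes by K makes them at least r while the boxes still exhaust the space. *)
pose K := Num.truncn r.
pose ik a : nat * nat := odflt (0%N, 0%N) (unpickle a).
pose m a : R := ((ik a).2 + K).+1%:R.
pose B a := A `&` U (ik a).1 `&` box (m a).
apply: (@hausdorff_measure_eq0 _ _ s A B m) => // [x Ax|a x []//|a c c0].
  have [i _ Ux] := AU _ Ax.
  pose k := Num.truncn (eucl_norm x).
  exists (pickle (i, k)) => //; rewrite /B /m /ik pickleK /=; split=> // b.
  apply: le_trans (coord_le_eucl_norm x b) _.
  by rewrite ltW // (lt_le_trans (truncnS_gt _)) // ler_nat ltnS leq_addr.
have mr : r <= m a.
  by rewrite ltW // (lt_le_trans (truncnS_gt _)) // ler_nat ltnS leq_addl.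
pose c' := Num.truncn c^-1.
have cc' : c'.+1%:R^-1 < c.
  by rewrite -[c]invrK ltf_pV2 ?posrE ?invr_gt0 // truncnS_gt.
have [d /andP[d0 d1] H] : exists2 d, 0 < d <= 1 &
    #|cells (m a) d (A `&` U (ik a).1)|%:R < d `^ (- s) / c'.+1%:R.
  apply: contrapT => H; apply: N; exists (ik a).1, ((ik a).2 + K)%N, c'.
  split=> // d d01.
  by rewrite leNgt; apply/negP => H'; apply: H; exists d.
exists d => //; apply: lt_trans cc'.
rewrite -ltr_pdivlMr ?powR_gt0 // -powRN mulrC; apply: le_lt_trans H.
rewrite ler_nat; apply/subset_leq_card/fintype.subsetP => k.
by move=> /mem_cells[x [mx [AUx _] xk]]; apply/mem_cells; exists x.
Qed.

End Main.

(** * Localisation of the family and choice of the small loss *)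

Theorem theorem6 (R : realType) (n : nat) (t : R)
    (PP : set (@aplane R n n.-1))
    (P' : @aplane R n n.-1 -> set 'rV[R]_n) :
  (2 <= n)%N ->
  0 < t ->
  packing_dim (@aplane_dist R n n.-1) PP = t%:E ->
  (forall P, PP P -> P' P `<=` aplane_points P) ->
  (forall P, PP P -> hausdorff_dim (@eucl_dist R n) (P' P) = (n%:R - 1)%:E) ->
  ((n%:R - 1 + n%:R * t / ((n%:R - 1) * t + n%:R))%:E
    <= packing_dim (@eucl_dist R n) (\bigcup_(P in PP) P' P))%E.
Proof.
move=> n2 t0 dimPP P'P dimP'.
have n0 : (0 < n)%N by exact: ltnW.
have n1 : 2 <= n%:R :> R by rewrite ler_nat.
apply: le_ereal_inf_tmp => _ [U FU <-].
apply/lee_addgt0Pr => e e0.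
(* A loss of 2 eps comes from s and one of at most eps from t - eps, which e / 3 absorbs. The other
   bounds keep s and t - eps positive. *)
pose eps : R := Num.min (e / 3) (Num.min (1 / 2) (t / 2)).
have eps0 : 0 < eps by rewrite !lt_min; lra.
have [epse eps1 epst] : [/\ eps <= e / 3, eps <= 1 / 2 & eps <= t / 2].
  by split; rewrite !ge_min lexx ?orbT.
pose s : R := n%:R - 1 - eps.
have s0 : 0 < s by rewrite /s; lra.
(* The index records the cover element, the box size, the constant in the lower cell count and the
   chart. *)
pose W (a : nat * nat * nat * 'I_n) := [set P | [/\ PP P,
  exists w, represents a.2 w P /\ box (a.1.1.2.+1%:R) w &
  forall d : R, 0 < d <= 1 -> d `^ (- s) / a.1.2.+1%:R <=
     #|cells a.1.1.2.+1%:R d (P' P `&` U a.1.1.1)|%:R]].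
have PPW : PP `<=` \bigcup_a W a.
  move=> P PPP; have [j [w wP]] := exists_represents P n0.
  have P'U : P' P `<=` \bigcup_i U i by move=> x Px; apply: FU; exists P.
  have mP : hausdorff_measure (@eucl_dist R n) s (P' P) <> 0%E.
    move=> m0; have : (hausdorff_dim (@eucl_dist R n) (P' P) <= s%:E)%E.
      by apply: ereal_inf_lbound; exists s => //; split=> //; exact: ltW.
    by rewrite dimP' // lee_fin /s; lra.
  have [i [k [c [rk kc]]]] := exists_piece (eucl_norm w) n0 s0 P'U mP.
  exists (i, k, c, j) => //; split=> //; exists w; split=> // a.
  exact: le_trans (coord_le_eucl_norm w a) rk.
have tPP : ((t - eps)%:E < packing_dim (@aplane_dist R n n.-1) PP)%E.
  by rewrite dimPP lte_fin; lra.
have [[[[i k] c] j] tW] := packing_dim_piece (0%N, 0%N, 0%N, Ordinal n0) PPW tPP.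
have te0 : 0 < t - eps by lra.
have := @piece_upper_box_dim R n j k.+1%:R s (t - eps) c _ P' (U i) n2.
move=> /(_ (W (i, k, c, j))) H.
have {H} H : ((2 * s - (n%:R - 1) + n%:R * (t - eps) /
    ((n%:R - 1) * (t - eps) + n%:R))%:E <= upper_box_dim (@eucl_dist R n) (U i))%E.
  apply: H => //.
  - by rewrite ler1n.
  - by move=> P [/P'P].
  - by move=> P [].
  - by move=> P [].
apply: (@le_trans _ _ (upper_box_dim (@eucl_dist R n) (U i) + e%:E)%E); last first.
  by apply: leeD2r; apply: ereal_sup_ubound; exists i.
rewrite -leeBlDr // -EFinB; apply: le_trans H; rewrite lee_fin.
have D0 : n%:R <= (n%:R - 1) * t + n%:R by rewrite lerDr mulr_ge0 //; lra.
have D1 : n%:R <= (n%:R - 1) * (t - eps) + n%:R by rewrite lerDr mulr_ge0 //; lra.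
suff : n%:R * t / ((n%:R - 1) * t + n%:R) - n%:R * (t - eps) /
    ((n%:R - 1) * (t - eps) + n%:R) <= eps by rewrite /s; lra.
(* Both denominators are at least n, so the factor in front of eps is at most 1. *)
have -> : n%:R * t / ((n%:R - 1) * t + n%:R) - n%:R * (t - eps) /
    ((n%:R - 1) * (t - eps) + n%:R) =
  n%:R * n%:R / (((n%:R - 1) * t + n%:R) * ((n%:R - 1) * (t - eps) + n%:R)) * eps.
  by field; apply/andP; split; apply/eqP; lra.
apply: ler_piMl; first exact: ltW.
rewrite ler_pdivrMr ?mul1r; last by apply: mulr_gt0; lra.
by apply: ler_pM => //; lra.
Qed.
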